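(* The following two equivalences hold. (a) $\mathrm{P}=\mathrm{NP}$ if and only if $\mathrm{P}/_{\sim}=\mathrm{NP}/_{\sim}$. (b) $\mathrm{P}=\mathrm{PSPACE}$ if and only if $\mathrm{P}/_{\sim}=\mathrm{PSPACE}/_{\sim}$. Here, for a complexity class $\mathcal{C}$, $\mathcal{C}/_{\sim}$ denotes the class of all bisimulation-invariant sets of $(\Sigma,\mathsf{Col})$-graphs (for arbitrary finite non-empty $\Sigma,\mathsf{Col}$) whose membership problem belongs to $\mathcal{C}$.
   Context: Let $\Sigma$ (alphabet) and $\mathsf{Col}$ (colours) be finite non-empty sets. A $(\Sigma,\mathsf{Col})$-graph is a tuple $\mathcal{G}=(V,\to,L,v_I)$ with a set $V$ of nodes, a root $v_I\in V$, labelled edges $\to\,\subseteq V\times\Sigma\times V$ (write $v\xrightarrow{a}v'$), and a labelling $L:V\to 2^{\mathsf{Col}}$. A bisimulation between $(\Sigma,\mathsf{Col})$-graphs $\mathcal{G}=(V,\to,L,v_I)$ and $\mathcal{G}'=(V',\to,L',v'_I)$ is a relation $R\subseteq V\times V'$ such that for all $(u,v)\in R$: $L(u)=L'(v)$; for all $a\in\Sigma$ and $u\xrightarrow{a}u'$ there is $v\xrightarrow{a}v'$ with $(u',v')\in R$; and for all $a\in\Sigma$ and $v\xrightarrow{a}v'$ there is $u\xrightarrow{a}u'$ with $(u',v')\in R$. Write $\mathcal{G}\sim\mathcal{G}'$ if some bisimulation contains $(v_I,v'_I)$. A set $\mathfrak{G}$ of $(\Sigma,\mathsf{Col})$-graphs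 is bisimulation-invariant if $\mathcal{G}\in\mathfrak{G}$ and $\mathcal{G}\sim\mathcal{G}'$ imply $\mathcal{G}'\in\mathfrak{G}$. Standing convention: attention is restricted to finitely representable graphs, i.e. finite graphs, or infinite graphs presented by a finite bisimilar graph (such as tree unfoldings of finite graphs, presented via back-edges). The membership problem of a set $\mathfrak{G}$ takes as input a finite graph encoded by adjacency lists or matrices, and complexity is measured in the size of this encoding. *)

(* Defs.v *)
From HB Require Import structures.
From mathcomp Require Import all_boot all_order all_algebra.
Set Implicit Arguments.
Unset Strict Implicit.
Unset Printing Implicit Defensive.
Import GRing.Theory Num.Theory.

Inductive move := MoveLeft | Stay | MoveRight.

Definition shift (m : move) : int :=
  match m with MoveLeft => (-1)%R | Stay => 0%R | MoveRight => 1%R end.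

(** A nondeterministic machine with [tapes.+1] two-way infinite read/write
    tapes over the finite tape alphabet [tm_symb]; tape [ord0] carries the input,
    a word over {0,1}.  [trans q s q' a] means: in state [q], reading [s i] on
    each tape [i], the machine may go to state [q'] while writing [(a i).1] and
    moving by [(a i).2] on each tape [i]. *)
Record TM := MkTM {
  tm_state : finType;
  tm_symb : finType;
  tapes : nat;
  blank : tm_symb;
  input_symb : bool -> tm_symb;
  input_symb_inj : injective input_symb;
  input_symb_blank : forall b, input_symb b != blank;
  start : tm_state;
  accepting : pred tm_state;
  trans : tm_state -> {ffun 'I_tapes.+1 -> tm_symb} ->
          tm_state -> {ffun 'I_tapes.+1 -> tm_symb * move} -> bool
}.

Definition deterministic (M : TM) : Prop :=
  forall (q : tm_state M) s q1 a1 q2 a2,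
    trans q s q1 a1 -> trans q s q2 a2 -> q1 = q2 /\ a1 = a2.

Record config (M : TM) := Config {
  cstate : tm_state M;
  head_pos : 'I_(tapes M).+1 -> int;
  cell : 'I_(tapes M).+1 -> int -> tm_symb M
}.

Definition init (M : TM) (x : seq bool) : config M :=
  {| cstate := start M;
     head_pos := fun _ => 0%R;
     cell := fun i z =>
       match z with
       | Posz k => if i == ord0 then nth (blank M) (map (@input_symb M) x) k
                   else blank M
       | Negz _ => blank M
       end |}.

Definition step (M : TM) (c c' : config M) : Prop :=
  exists q' a,
    trans (cstate c) [ffun i => cell c i (head_pos c i)] q' a /\
    c' = {| cstate := q';
            head_pos := fun i => (head_pos c i + shift (a i).2)%R;
            cell := fun i z =>
              if z == head_pos c i then (a i).1 else cell c i z |}.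

Fixpoint steps (M : TM) (n : nat) (c c' : config M) : Prop :=
  if n is n'.+1 then exists2 d, step c d & steps n' d c' else c = c'.

Definition halted (M : TM) (c : config M) : Prop := forall c', ~ step c c'.

Definition accepts (M : TM) (x : seq bool) : Prop :=
  exists n c, [/\ steps n (init M x) c, halted c & accepting (cstate c)].

(** Every computation branch halts. *)
Definition halts (M : TM) (x : seq bool) : Prop :=
  exists t, forall n c, steps n (init M x) c -> n <= t.

Definition language := seq bool -> Prop.

Definition decides (M : TM) (L : language) : Prop :=
  forall x, halts M x /\ (L x <-> accepts M x).

Definition runs_in_time (M : TM) (f : nat -> nat) : Prop :=
  forall x n c, steps n (init M x) c -> n <= f (size x).

(** Every head stays in the cells [-f |x|, ..., f |x|] of its tape. *)
Definition runs_in_space (M : TM) (f : nat -> nat) : Prop :=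
  forall x n c, steps n (init M x) c ->
  forall i, absz (head_pos c i) <= f (size x).

Definition PTIME (L : language) : Prop :=
  exists (M : TM) (p : {poly nat}),
    [/\ deterministic M, decides M L & runs_in_time M (fun n => p.[n]%R)].

Definition NPTIME (L : language) : Prop :=
  exists (M : TM) (p : {poly nat}),
    decides M L /\ runs_in_time M (fun n => p.[n]%R).

Definition PSPACE (L : language) : Prop :=
  exists (M : TM) (p : {poly nat}),
    [/\ deterministic M, decides M L & runs_in_space M (fun n => p.[n]%R)].

Record lgraph (Sigma Col : finType) := LGraph {
  node : Type;
  edge : node -> Sigma -> node -> Prop;
  label : node -> {set Col};
  lroot : node
}.

Definition bisimulation (Sigma Col : finType) (G G' : lgraph Sigma Col)
    (R : node G -> node G' -> Prop) : Prop :=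
  forall u v, R u v ->
    [/\ label u = label v,
        forall a u', edge u a u' -> exists2 v', edge v a v' & R u' v'
      & forall a v', edge v a v' -> exists2 u', edge u a u' & R u' v'].

Definition bisimilar (Sigma Col : finType) (G G' : lgraph Sigma Col) : Prop :=
  exists2 R : node G -> node G' -> Prop,
    bisimulation R & R (lroot G) (lroot G').

Record fgraph (Sigma Col : finType) := FGraph {
  forder : nat;
  fedge : 'I_forder -> Sigma -> 'I_forder -> bool;
  flabel : 'I_forder -> {set Col};
  froot : 'I_forder
}.

Definition lgraph_of_fgraph (Sigma Col : finType) (G : fgraph Sigma Col) :
    lgraph Sigma Col :=
  {| node := 'I_(forder G);
     edge := fun u a v => fedge u a v;
     label := @flabel _ _ G;
     lroot := froot G |}.
Coercion lgraph_of_fgraph : fgraph >-> lgraph.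

Definition finitely_representable (Sigma Col : finType)
    (G : lgraph Sigma Col) : Prop :=
  exists H : fgraph Sigma Col, bisimilar G H.

Definition graph_class (Sigma Col : finType) := lgraph Sigma Col -> Prop.

Definition bisimulation_invariant (Sigma Col : finType)
    (GG : graph_class Sigma Col) : Prop :=
  forall G G', GG G -> bisimilar G G' -> GG G'.

(** The order in unary, the root as a one-hot vector, the adjacency matrix of
    each edge label (row by row), and the indicator vector of each colour. *)
Definition encode (Sigma Col : finType) (G : fgraph Sigma Col) : seq bool :=
  let nodes := enum 'I_(forder G) in
  nseq (forder G) true ++ false ::
  [seq v == froot G | v <- nodes] ++
  flatten [seq [seq fedge u a v | u <- nodes, v <- nodes] | a <- enum Sigma] ++
  [seq c \in flabel v | c <- enum Col, v <- nodes].

Definition membership_problem (Sigma Col : finType)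
    (GG : graph_class Sigma Col) : language :=
  fun x => exists2 G : fgraph Sigma Col, x = encode G & GG G.

(** [mod_bisim C] is the class C/~; its members are graph classes over
    arbitrary finite non-empty sets [Sigma] and [Col].  Only finitely
    representable graphs are considered, so that a bisimulation-invariant class
    is determined by its finite members. *)
Definition mod_bisim (C : language -> Prop) (Sigma Col : finType)
    (GG : graph_class Sigma Col) : Prop :=
  [/\ 0 < #|Sigma|, 0 < #|Col|,
      forall G, GG G -> finitely_representable G,
      bisimulation_invariant GG
    & C (membership_problem GG)].

(* Main.v *)
From Pilot Require Import Defs.
From Stdlib Require Import FunctionalExtensionality.
From HB Require Import structures.
From mathcomp Require Import all_boot all_order all_algebra zify.
Set Implicit Arguments.
Unset Strict Implicit.
Unset Printing Implicit Defensive.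
Import Order.TTheory GRing.Theory Num.Theory.
(* The names [fgraph], [froot] and others are shadowed by MathComp otherwise. *)
Import Pilot.Defs.

(** Only the implications from right to left are not immediate.  A graph over one
    edge label and one colour spells a word: its [i]-th letter tells whether some
    node at the end of a walk of length [i] from the root is coloured, and the
    word ends with the last level that a walk can reach.  The word is invariant
    under bisimulation, so a language [L] yields the bisimulation-invariant class
    of the graphs spelling a word of [L].  The membership problem of this class
    and [L] reduce to each other in polynomial time: levels are computed one by
    one from the adjacency matrix, at most as many as there are nodes since
    otherwise there is an infinite walk; conversely a word is turned into the
    encoding of a labelled path.  Both reductions are multi-tape machines, which
    are run before a machine for the target problem. *)

(** * Machine runs and transducers *)

(** A membership problem contains encodings only, so the machine from graphs to words must also
    reject malformed inputs, besides the graphs with infinite walks. No word outside [L] need exist,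
    so it rejects by getting stuck rather than by a chosen output. Graphs with the same encoding are
    never compared directly: the output on [encode G] is the word of [G], so determinism makes such
    graphs spell the same word. In a composition the second machine takes over the output tape with
    all heads where they happen to be; this is harmless because machine steps commute with
    translations of each tape. The idle time and displacement of the first phase only add a
    polynomial to the bounds. *)

Lemma horner_nat_le (p : {poly nat}) (m n : nat) :
  m <= n -> p.[m]%R <= p.[n]%R.
Proof.
move=> le_mn; elim/poly_ind: p => [|p c IHp]; first by rewrite !horner0.
rewrite !hornerD !hornerM !hornerX !hornerC leq_add2r.
exact: leq_mul.
Qed.

Section MachineRuns.
Variable M : TM.

Lemma steps_cat m n (c d e : config M) :
  steps m c d -> steps n d e -> steps (m + n) c e.
Proof.
elim: m c => [|m IHm] c /=; first by move->.
by case=> c' cc' /IHm IH /IH; exists c'.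
Qed.

(** A step moves a head by at most one cell; this turns time bounds into space bounds. *)
Lemma steps_head n (c c' : config M) i :
  steps n c c' -> absz (head_pos c' i) <= absz (head_pos c i) + n.
Proof.
elim: n c => [|n IHn] c /=; first by move<-; rewrite addn0.
case=> d [q [a [_ ->]]] /IHn /=; case: (a i).2 => /=; lia.
Qed.

End MachineRuns.

Lemma PTIME_NPTIME L : PTIME L -> NPTIME L.
Proof. by case=> M [p] []; exists M, p. Qed.

Lemma PTIME_PSPACE L : PTIME L -> PSPACE L.
Proof.
case=> M [p] [detM decM timeM]; exists M, p; split=> // x n c run i.
have := steps_head i run; have := timeM x n c run.
by rewrite /= add0n => le_np /leq_trans; apply.
Qed.

(** A zipper [(l, r)] is a tape whose head reads the first symbol of [r]; [l]
    lists the symbols to the left of the head, nearest first.  Both sides are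
    followed by blanks, and the absolute position of the head is forgotten. *)
Definition symb := option bool.
Definition zipper := (seq symb * seq symb)%type.
Definition action := (option symb * move)%type.

Notation blank_zipper := ([::], [::]).
Notation keep := (None, Stay).

Definition zread (z : zipper) : symb := head None z.2.

Definition zwrite (w : option symb) (z : zipper) : zipper :=
  if w is Some g then (z.1, g :: behead z.2) else z.

Definition zmove (m : move) (z : zipper) : zipper :=
  match m, z with
  | Stay, _ => z
  | MoveRight, (l, x :: r) => (x :: l, r)
  | MoveRight, (l, [::]) => (None :: l, [::])
  | MoveLeft, (x :: l, r) => (l, x :: r)
  | MoveLeft, ([::], r) => ([::], None :: r)
  end.

Definition zact (a : action) (z : zipper) : zipper := zmove a.2 (zwrite a.1 z).

Fixpoint zacts (acts : seq action) (zs : seq zipper) : seq zipper :=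
  match zs, acts with
  | z :: zs', a :: acts' => zact a z :: zacts acts' zs'
  | _, _ => zs
  end.

Lemma size_zacts acts zs : size (zacts acts zs) = size zs.
Proof. by elim: zs acts => [|z zs IH] [|a acts] //=; rewrite IH. Qed.

Lemma nth_zacts acts zs i : i < size zs ->
  nth blank_zipper (zacts acts zs) i =
  zact (nth keep acts i) (nth blank_zipper zs i).
Proof.
elim: zs acts i => [|z zs IH] [|a acts] [|i] //= lt_i; exact: IH.
Qed.

(** Offsets are relative to the head; [Negz k] is -(k+1), hence entry [k] of the left list. *)
Definition zcell (z : zipper) (y : int) : symb :=
  match y with Posz k => nth None z.2 k | Negz k => nth None z.1 k end.

Lemma zcell_write w z y :
  zcell (zwrite w z) y = if y == 0%R then odflt (zcell z y) w else zcell z y.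
Proof.
case: w => [g|]; last by case: eqP.
by case: y => [[|k]|k] //=; rewrite ?nth_behead.
Qed.

Lemma zcell_move m z y : zcell (zmove m z) y = zcell z (y + shift m)%R.
Proof.
case: m => /=; last first.
- case: y => k; first by rewrite -PoszD addn1; case: z => l [|x r]; rewrite //= nth_nil.
  case: k => [|k]; first by case: z => l [|x r].
  have -> : (Negz k.+1 + 1 = Negz k)%R by lia.
  by case: z => l [|x r].
- by rewrite addr0.
case: y => k; last first.
  have -> : (Negz k - 1 = Negz k.+1)%R by lia.
  by case: z => [[|x l] r]; rewrite /= ?nth_nil.
case: k => [|k]; first by case: z => [[|x l] r].
have -> : (Posz k.+1 - 1 = Posz k)%R by lia.
by case: z => [[|x l] r].
Qed.

(** A deterministic multi-tape machine that rewrites its input (on tape [0])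
    into an output (on tape [aux_tapes.+1]); [None] as a target state is the exit,
    and [None] as a value of [delta] means that the machine is stuck, which
    stands for rejection. *)
Record transducer := Transducer {
  tstate : finType;
  aux_tapes : nat;
  tstart : tstate;
  delta : tstate -> seq symb -> option (option tstate * seq action)
}.

(** The index [t] is an upper bound on the number of steps, since both final constructors accept any
    [t]. The output is compared cell by cell because a zipper may carry explicit trailing blanks. *)
Inductive outcome (T : transducer) :
  nat -> option (tstate T) -> seq zipper -> option (seq bool) -> Prop :=
| OutcomeExit t zs l r w :
    nth blank_zipper zs (aux_tapes T).+1 = (l, r) ->
    (forall k, nth None l k = None) ->
    (forall k, nth None r k = nth None (map Some w) k) ->
    outcome t None zs (Some w)
| OutcomeStuck t q zs :
    delta q (map zread zs) = None -> outcome t (Some q) zs None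
| OutcomeStep t q zs q' acts r :
    delta q (map zread zs) = Some (q', acts) ->
    outcome t q' (zacts acts zs) r ->
    outcome t.+1 (Some q) zs r.

(** The default [None] differs from every letter, so the cells also determine the length. *)
Lemma bits_inj (v w : seq bool) :
  (forall k, nth None (map Some v) k = nth None (map Some w) k) -> v = w.
Proof.
elim: v w => [|a v IH] [|b w] // e; try by have := e 0.
by have [->] := e 0; rewrite (IH w) // => k; apply: (e k.+1).
Qed.

Lemma outcome_det (T : transducer) t t' q zs r r' :
  @outcome T t q zs r -> @outcome T t' q zs r' -> r = r'.
Proof.
move=> H; elim: H t' r' => {t q zs r}.
- move=> t zs l s w e _ ew t' r' H; inversion H as [? ? l' s' w' e' _ ew'| |]; subst.
  move: e'; rewrite e => -[_ es]; congr Some; apply: bits_inj => k.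
  by rewrite -ew es ew'.
- by move=> t q zs e t' r' H; inversion H as [|? ? ? e'|? ? ? ? ? ? e']; congruence.
move=> t q zs q' acts r e _ IH t' r' H.
inversion H as [|? ? ? e'|? ? ? ? ? ? e' H']; subst; first by congruence.
by move: e'; rewrite e => -[? ?]; subst; apply: IH H'.
Qed.

Lemma outcome_le (T : transducer) t t' q zs r :
  t <= t' -> @outcome T t q zs r -> @outcome T t' q zs r.
Proof.
move=> + H; elim: H t' => {t q zs r}; [|by constructor|].
  by move=> t zs l s w e1 e2 e3 t' _; apply: OutcomeExit e1 e2 e3.
by move=> t q zs q' acts r e _ IH [|t'] // /IH; apply: OutcomeStep.
Qed.

(** With an explicit blank on the left, stepping off the left end and back restores the very same
    zipper; from [[::]] it would leave a new [None] behind. *)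
Definition tinit (T : transducer) (x : seq bool) : seq zipper :=
  ([:: None], map Some x) :: nseq (aux_tapes T).+1 ([:: None], [::]).

(** A many-one reduction, except that a stuck run counts as a negative answer. *)
Definition reduces (T : transducer) (p : {poly nat}) (L' L : language) : Prop :=
  forall x, exists r, [/\ outcome p.[size x]%R (Some (tstart T)) (tinit T x) r,
    size (odflt [::] r) <= p.[size x]%R
    & L' x <-> exists2 w, r = Some w & L w].

(** * Running a machine on the output of a transducer *)

Definition move_eqb (a b : move) : bool :=
  match a, b with
  | MoveLeft, MoveLeft | Stay, Stay | MoveRight, MoveRight => true
  | _, _ => false
  end.

Lemma move_eqbP : Equality.axiom move_eqb.
Proof. by case=> [] []; constructor. Qed.

HB.instance Definition _ := hasDecEq.Build move move_eqbP.

Section Composition.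
Variables (T : transducer) (M : TM).
Local Notation k := (aux_tapes T).
Local Notation m := (tapes M).
Local Notation A := (tm_symb M).

Definition enc_symb (g : symb) : A :=
  if g is Some b then @input_symb M b else blank M.

(** Symbols of [M] that are neither blank nor letters get an arbitrary value; they never occur while
    [T] runs. *)
Definition dec_symb (a : A) : symb :=
  if a == blank M then None else Some (a == @input_symb M true).

Lemma enc_symbK : cancel enc_symb dec_symb.
Proof.
case=> [b|]; rewrite /dec_symb /= ?eqxx // (negbTE (@input_symb_blank M b)).
by case: b; rewrite ?eqxx // (inj_eq (@input_symb_inj M)).
Qed.

Definition comp_state : finType := (tstate T + tm_state M)%type.

Definition enter (q : option (tstate T)) : comp_state :=
  if q is Some q' then inl q' else inr (start M).

(** Of the [k + m + 2] tapes, the first [k + 2] belong to [T] and the last [m + 1] to [M], so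
    exactly one is shared. *)
Definition comp_reads (s : {ffun 'I_(k + m.+1).+1 -> A}) : seq symb :=
  take k.+2 [seq dec_symb (s i) | i <- enum 'I_(k + m.+1).+1].

Definition comp_action (acts : seq action) (s : {ffun 'I_(k + m.+1).+1 -> A}) :
    {ffun 'I_(k + m.+1).+1 -> A * move} :=
  [ffun i : 'I_(k + m.+1).+1 => let a := if i < k.+2 then nth keep acts i else keep in
             (if a.1 is Some g then enc_symb g else s i, a.2)].

(** In the second phase the other tapes of [T] are forced to stay as they are, so that an action of
    [M] extends in exactly one way and determinism is inherited. *)
Definition comp_trans (q : comp_state) (s : {ffun 'I_(k + m.+1).+1 -> A})
    (q' : comp_state) (a : {ffun 'I_(k + m.+1).+1 -> A * move}) : bool :=
  match q, q' with
  | inl p, _ => if delta p (comp_reads s) is Some (p', acts)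
                then (q' == enter p') && (a == comp_action acts s) else false
  | inr p, inr p' =>
      trans p [ffun j => s (rshift k.+1 j)] p' [ffun j => a (rshift k.+1 j)]
      && [forall i : 'I_k.+1,
            a (lshift m.+1 i) == (s (lshift m.+1 i), Stay)]
  | inr _, inl _ => false
  end.

(** The output tape of [T], of index [k.+1], is the input tape of [M]. *)
Definition comp : TM :=
  {| tm_state := comp_state; tm_symb := A; tapes := k + m.+1; blank := blank M;
     input_symb := @input_symb M; input_symb_inj := @input_symb_inj M;
     input_symb_blank := @input_symb_blank M; start := inl (tstart T);
     accepting := fun q => if q is inr p then accepting p else false;
     trans := comp_trans |}.

Lemma comp_deterministic : deterministic M -> deterministic comp.
Proof.
move=> detM [p|p] s q1 a1 q2 a2 /=.
  by case: delta => // -[p' acts] /andP[/eqP-> /eqP->] /andP[/eqP-> /eqP->].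
case: q1 q2 => // p1 [] // p2 /andP[t1 /forallP f1] /andP[t2 /forallP f2].
have [-> e] := detM _ _ _ _ _ _ t1 t2; split=> //.
apply/ffunP=> i; rewrite -(@splitK k.+1 m.+1 i) /unsplit; case: split => j /=.
  by move: (f1 j) (f2 j) => /eqP-> /eqP->.
by move/ffunP: e => /(_ j); rewrite !ffunE.
Qed.

Section FirstPhase.

Definition shows (z : zipper) (h : int) (cl : int -> A) : Prop :=
  forall y, cl (h + y)%R = enc_symb (zcell z y).

Lemma shows_read z h cl : shows z h cl -> cl h = enc_symb (zread z).
Proof. by move/(_ 0%R); rewrite addr0 => ->; case: z => l []. Qed.

Lemma shows_act a z h cl : shows z h cl ->
  shows (zact a z) (h + shift a.2)%R
    (fun y => if y == h then (if a.1 is Some g then enc_symb g else cl h)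
              else cl y).
Proof.
move=> zh y; rewrite zcell_move zcell_write -addrA (addrC _ y).
have -> : ((h + (y + shift a.2) == h) = (y + shift a.2 == 0))%R by lia.
by case: eqP => [e|_]; case: a.1 => [g|] //=; rewrite -{1}(addr0 h)  ?e zh // e.
Qed.

(** The tapes of [M] other than its input lie beyond [zs]; for them the default value of [nth] says
    that they are still blank. *)
Definition represents (q : option (tstate T)) (zs : seq zipper)
    (c : config comp) : Prop :=
  [/\ size zs = k.+2, cstate c = enter q
    & forall i : 'I_(tapes comp).+1,
        shows (nth blank_zipper zs i) (head_pos c i) (cell c i)].

Lemma represents_reads q zs c : represents q zs c ->
  comp_reads [ffun i => cell c i (head_pos c i)] = map zread zs.
Proof.
case=> sz _ rep; have sz' : size (comp_reads [ffun i => cell c i (head_pos c i)]) = k.+2.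
  by rewrite size_takel // size_map size_enum_ord addnS ltnS ltnS leq_addr.
apply: (@eq_from_nth _ None); first by rewrite sz' size_map sz.
move=> i; rewrite sz' => lt_i; have lt_i' : i < (k + m.+1).+1.
  by apply: leq_trans lt_i _; rewrite addnS !ltnS leq_addr.
rewrite nth_take // (nth_map ord0) ?size_enum_ord // ffunE (shows_read (rep _)).
by rewrite enc_symbK (nth_map blank_zipper) ?sz // nth_enum_ord.
Qed.

(** The successor is unique even if [M] is nondeterministic, because only [T] acts in this phase. *)
Lemma represents_step q zs c q' acts :
  represents (Some q) zs c -> delta q (map zread zs) = Some (q', acts) ->
  exists2 c', step c c'
    & represents q' (zacts acts zs) c' /\ forall c'', step c c'' -> c'' = c'.
Proof.
move=> rep e; have re := represents_reads rep; case: rep => sz ec rep.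
pose s : {ffun 'I_(k + m.+1).+1 -> A} := [ffun i => cell c i (head_pos c i)].
pose a := comp_action acts s.
exists (@Config comp (enter q') (fun i => head_pos c i + shift (a i).2)%R
  (fun i z => if z == head_pos c i then (a i).1 else cell c i z)).
  by exists (enter q'), a; split=> //=; rewrite ec /= re e !eqxx.
split; last first.
  by case=> ? ? ? [q1 [a1 [/=]]]; rewrite ec /= re e => /andP[/eqP-> /eqP->] ->.
split=> [||i] //=; first by rewrite size_zacts.
rewrite /a !ffunE; case: ltnP => lt_i /=.
  by rewrite nth_zacts ?sz //; apply: shows_act.
rewrite nth_default ?size_zacts ?sz //.
have := shows_act keep (rep i); rewrite nth_default ?sz //=.
Qed.

Lemma represents_stuck q zs c :
  represents (Some q) zs c -> delta q (map zread zs) = None -> halted c.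
Proof.
move=> rep e c'; have re := represents_reads rep; case: rep => _ ec _.
by case=> q1 [a [/=]]; rewrite ec /= re e.
Qed.

Lemma enc_nth x n :
  enc_symb (nth None (map Some x) n) = nth (blank M) (map (@input_symb M) x) n.
Proof.
case: (ltnP n (size x)) => lt_n; last by rewrite !nth_default ?size_map.
by rewrite !(nth_map false).
Qed.

Lemma represents_init x :
  represents (Some (tstart T)) (tinit T x) (init comp x).
Proof.
split=> //= [|i y]; first by rewrite size_nseq.
rewrite add0r; case: i => [[|i] lt_i] /=.
  case: y => [n|[|n]] //=; last by rewrite nth_nil.
  by rewrite enc_nth.
have -> : zcell (nth blank_zipper (nseq k.+1 ([:: None], [::])) i) y = None.
  by rewrite nth_nseq; case: ifP => _; case: y => [n|[|n]]; rewrite /= ?nth_nil.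
by case: y.
Qed.
End FirstPhase.

Section SecondPhase.

(** The heads of the tapes of [M] may be anywhere when [M] starts, hence the
    translation by [o]. *)
Definition project (o : 'I_m.+1 -> int) (c : config comp) : config M :=
  {| cstate := if cstate c is inr p then p else start M;
     head_pos := fun j => (head_pos c (rshift k.+1 j) - o j)%R;
     cell := fun j z => cell c (rshift k.+1 j) (z + o j)%R |}.

Definition second (c : config comp) : bool :=
  if cstate c is inr _ then true else false.

Lemma project_reads o c :
  [ffun j => cell (project o c) j (head_pos (project o c) j)] =
  [ffun j => [ffun i : 'I_(tapes comp).+1 => cell c i (head_pos c i)]
               (rshift k.+1 j)].
Proof. by apply/ffunP=> j; rewrite !ffunE /= subrK. Qed.

Lemma config_ext (N : TM) (c d : config N) :
  cstate c = cstate d -> head_pos c =1 head_pos d -> cell c =2 cell d -> c = d.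
Proof.
case: c d => [q h cl] [q' h' cl'] /= -> eh ecl; congr Config.
  exact: functional_extensionality.
by apply: functional_extensionality => j; apply: functional_extensionality.
Qed.

Lemma project_step o c c' : second c -> step c c' ->
  [/\ second c', step (project o c) (project o c')
    & forall i : 'I_k.+1, head_pos c' (lshift m.+1 i) = head_pos c (lshift m.+1 i)].
Proof.
case: c => q h cl; case: q => // p _ [q' [a [/=]]]; case: q' => // p'.
move=> /andP[tr /forallP fr] ->; split=> //=; last first.
  by move=> i; move/eqP: (fr i) => -> /=; rewrite addr0.
exists p', [ffun j => a (rshift k.+1 j)]; split; first by rewrite project_reads.
apply: config_ext => //= [j|j z]; rewrite !ffunE; first by rewrite addrAC.
by rewrite eq_sym -subr_eq eq_sym.
Qed.

Lemma project_stepV o c d : second c -> step (project o c) d ->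
  exists2 c', step c c' & second c' /\ project o c' = d.
Proof.
case: c => q h cl; case: q => // p _ [p' [a []]].
rewrite project_reads /= => tr ->.
pose s : {ffun 'I_(tapes comp).+1 -> A} := [ffun i => cl i (h i)].
pose b : {ffun 'I_(tapes comp).+1 -> A * move} :=
  [ffun i => match @split k.+1 m.+1 i with
             | inl i' => (s i, Stay) | inr j => a j end].
have br j : b (rshift k.+1 j) = a j.
  by rewrite /b ffunE; case: split_ordP => j' /eqP;
     rewrite ?eq_rlshift ?eq_rshift // => /eqP->.
have bl (i : 'I_k.+1) : b (lshift m.+1 i) = (s (lshift m.+1 i), Stay).
  rewrite /b ffunE; case: split_ordP => j' e' //.
  by move/eqP: e'; rewrite eq_lrshift.
exists (@Config comp (inr p') (fun i => h i + shift (b i).2)%R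
  (fun i z => if z == h i then (b i).1 else cl i z)).
  exists (inr p'), b; split=> //=; apply/andP; split.
    by rewrite (_ : [ffun j => b _] = a) //; apply/ffunP=> j; rewrite ffunE br.
  by apply/forallP=> i; rewrite bl.
split=> //; apply: config_ext => //= [j|j z]; rewrite !br; first by rewrite addrAC.
by rewrite eq_sym -subr_eq eq_sym.
Qed.

Lemma project_steps o n c c' : second c -> steps n c c' ->
  [/\ second c', steps n (project o c) (project o c')
    & forall i : 'I_k.+1, head_pos c' (lshift m.+1 i) = head_pos c (lshift m.+1 i)].
Proof.
elim: n c => [|n IHn] c sc /=; first by move<-.
case=> d /(project_step o sc)[sd st hd] /(IHn _ sd)[sc' sts hc'].
by split=> // [|i]; [exists (project o d) | rewrite hc' hd].
Qed.

Lemma project_stepsV o n c d : second c -> steps n (project o c) d ->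
  exists2 c', steps n c c' & second c' /\ project o c' = d.
Proof.
elim: n c => [|n IHn] c sc /=; first by move<-; exists c.
case=> d1 /(project_stepV sc)[c1 cc1 [sc1 <-]] /(IHn _ sc1)[c' c1c' [sc' <-]].
by exists c' => //; exists c1.
Qed.

Lemma project_halted o c : second c -> halted c <-> halted (project o c).
Proof.
move=> sc; split=> hc d; first by case/(project_stepV sc)=> c' /hc.
by case/(project_step o sc)=> _ /hc.
Qed.

End SecondPhase.

Definition first (c : config comp) : bool := ~~ second c.

Lemma outcome_None t q zs r c : outcome t q zs r -> r = None ->
  represents q zs c ->
  forall n c', steps n c c' -> n <= t /\ first c'.
Proof.
move=> out; elim: out c => {t q zs r} // [t q zs e|t q zs q' acts r e _ IH] c er rep.
  case=> [|n] c' /=; last by case=> d /(represents_stuck rep e).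
  by move<-; case: rep => _ ec _; rewrite /first /second ec.
have [d _ [rd ud]] := represents_step rep e.
case=> [|n] c' /=; first by move<-; case: rep => _ ec _; rewrite /first /second ec.
by case=> d' /ud ->; apply: IH.
Qed.

(** As the first phase does not branch, every run is either still inside it or has passed through
    the same handover [c1]. Taking the head positions in [c1] as offsets [o] makes its projection
    the initial configuration of [M]. *)
Lemma outcome_Some t q zs r w c : outcome t q zs r -> r = Some w ->
  represents q zs c ->
  exists t' c1 o,
    [/\ t' <= t, steps t' c c1, second c1, project o c1 = init M w
      & forall j, o j = head_pos c1 (rshift k.+1 j)] /\
    forall n c', steps n c c' ->
      (n < t' /\ first c') \/ (t' <= n /\ steps (n - t') c1 c').
Proof.
move=> out; elim: out c => {t q zs r} // [t zs l s w' e el es|t q zs q' acts r e _ IH] c er rep.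
  case: rep => sz ec rep; exists 0, c, (fun j => head_pos c (rshift k.+1 j)).
  split; last by move=> n c' st; right; rewrite subn0.
  split=> //; first by rewrite /second ec.
  apply: config_ext => [|j|j z]; [by rewrite /= ec|by rewrite /= subrr|].
  rewrite /= addrC rep /= addSn; case: er => <-; case: j => [[|j] lt_j].
    rewrite addn0 e; case: z => n /=; first by rewrite es enc_nth.
    by rewrite el.
  rewrite /= nth_default; last by rewrite sz; lia.
  by case: z => n; rewrite /= nth_nil.
have [d cd [rd ud]] := represents_step rep e.
have [t' [c1 [o [[le_t st s1 e1 oh] H]]]] := IH d er rd.
exists t'.+1, c1, o; split; first by split=> //; exists d.
case=> [|n] c' /=.
  by move<-; left; case: rep => _ ec _; rewrite /first /second ec.
by case=> d' /ud -> /H; rewrite ltnS subSS.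
Qed.

Variables (p : {poly nat}) (L' L : language).
Hypotheses (redT : reduces T p L' L) (decM : decides M L).

Lemma comp_decides : decides comp L'.
Proof.
move=> x; have [r [out _ ->]] := redT x; case: r out => [w|] out; last first.
  have H := outcome_None out erefl (represents_init x); split.
    by exists p.[size x]%R => n c /H[].
  split=> [[w] //|[n [c [/H[_]]]]]; rewrite /first /second /=.
  by case: (cstate c).
have [t' [c1 [o [[le_t st s1 e1 oh] H]]]] := outcome_Some out erefl (represents_init x).
have [[b hb] accM] := decM w; split.
  exists (t' + b) => n c /H[[lt_n _]|[le_n run]]; first by lia.
  have [_ run' _] := project_steps o s1 run.
  by rewrite e1 in run'; have := hb _ _ run'; lia.
split=> [[w' [<-] /accM]|] [n [c [run hc ac]]].
  rewrite -e1 in run; have [c' run' [sc' ec']] := project_stepsV s1 run.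
  exists (t' + n), c'; split; first exact: steps_cat run'.
    by apply/(project_halted o sc'); rewrite ec'.
  by move: sc' ac; rewrite -ec' /second /=; case: (cstate c').
exists w => //; apply/accM.
case: (H _ _ run) => [[_]|[_ run1]].
  by rewrite /first /second; move: ac => /=; case: (cstate c).
have [sc run2 _] := project_steps o s1 run1; rewrite e1 in run2.
exists (n - t'), (project o c); split=> //; first exact/project_halted.
by move: sc ac; rewrite /second /=; case: (cstate c).
Qed.

Lemma comp_time (pM : {poly nat}) :
  runs_in_time M (fun n => pM.[n]%R) ->
  runs_in_time comp (fun n => (p + (pM \Po p)).[n]%R).
Proof.
move=> timeM x n c run; rewrite hornerD horner_comp.
have [r [out le_r _]] := redT x; case: r out le_r => [w|] out le_r; last first.
  have [le_n _] := outcome_None out erefl (represents_init x) run.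
  exact: leq_trans le_n (leq_addr _ _).
have [t' [c1 [o [[le_t st s1 e1 oh] H]]]] := outcome_Some out erefl (represents_init x).
case: (H _ _ run) => [[lt_n _]|[le_n run1]].
  exact: leq_trans (ltnW lt_n) (leq_trans le_t (leq_addr _ _)).
have [_ run2 _] := project_steps o s1 run1; rewrite e1 in run2.
rewrite -(subnKC le_n); apply: leq_add => //.
by apply: leq_trans (timeM _ _ _ run2) _; apply: horner_nat_le.
Qed.

(** At the handover every head is within [p] of the origin, because at most [p] steps were made;
    from there the heads of [M] move within their own bound and the others stand still. *)
Lemma comp_space (pM : {poly nat}) :
  runs_in_space M (fun n => pM.[n]%R) ->
  runs_in_space comp (fun n => (p + (pM \Po p)).[n]%R).
Proof.
move=> spaceM x n c run i; rewrite hornerD horner_comp.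
have [r [out le_r _]] := redT x; case: r out le_r => [w|] out le_r; last first.
  have [le_n _] := outcome_None out erefl (represents_init x) run.
  have := steps_head i run; rewrite /= add0n => /leq_trans; apply.
  exact: leq_trans le_n (leq_addr _ _).
have [t' [c1 [o [[le_t st s1 e1 oh] H]]]] := outcome_Some out erefl (represents_init x).
case: (H _ _ run) => [[lt_n _]|[le_n run1]].
  have := steps_head i run; rewrite /= add0n => /leq_trans; apply.
  exact: leq_trans (ltnW lt_n) (leq_trans le_t (leq_addr _ _)).
have [_ run2 hd] := project_steps o s1 run1; rewrite e1 in run2.
have := fun j => steps_head j st; rewrite /= => h1.
rewrite -(@splitK k.+1 m.+1 i) /unsplit; case: split => j.
  have := h1 (lshift m.+1 j); rewrite hd add0n => /leq_trans; apply.
  exact: leq_trans le_t (leq_addr _ _).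
have := spaceM _ _ _ run2 j; have := horner_nat_le pM le_r; rewrite /= oh.
have := h1 (rshift k.+1 j) => ho le_q hs.
suff: absz (head_pos c (rshift k.+1 j)) <= (p.[size x]%R + pM.[p.[size x]]%R)%N by [].
by lia.
Qed.

End Composition.

Section Closure.
Variables (T : transducer) (p : {poly nat}) (L' L : language).
Hypothesis redT : reduces T p L' L.

Lemma PTIME_reduces : PTIME L -> PTIME L'.
Proof.
case=> M [q [detM decM timeM]]; exists (comp T M), (p + (q \Po p))%R.
split; [exact: comp_deterministic | exact: comp_decides redT decM|].
exact: comp_time redT _ timeM.
Qed.

Lemma NPTIME_reduces : NPTIME L -> NPTIME L'.
Proof.
case=> M [q [decM timeM]]; exists (comp T M), (p + (q \Po p))%R.
by split; [exact: comp_decides redT decM | exact: comp_time redT _ timeM].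
Qed.

Lemma PSPACE_reduces : PSPACE L -> PSPACE L'.
Proof.
case=> M [q [detM decM spaceM]]; exists (comp T M), (p + (q \Po p))%R.
split; [exact: comp_deterministic | exact: comp_decides redT decM|].
exact: comp_space redT _ spaceM.
Qed.

End Closure.

(** * From words to encodings of paths *)

(** The shift by 1 keeps the bound positive at length 0 and lets it absorb lower-order terms. *)
Definition cubic (c : nat) : {poly nat} := (c%:P * ('X + 1%:P) ^+ 3)%R.

Lemma cubicE c n : (cubic c).[n]%R = c * n.+1 ^ 3.
Proof.
rewrite /cubic hornerM horner_exp hornerD hornerX !hornerC -[n.+1]addn1.
by rewrite !exprS expr0 mulr1 !expnS expn0 muln1.
Qed.

Arguments zmove : simpl nomatch.
Notation bits := (map Some).
Notation goL := (None, MoveLeft).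
Notation goR := (None, MoveRight).
Notation put b := (Some (Some b), Stay).
Notation putR b := (Some (Some b), MoveRight).

Lemma ncons_cons (A : Type) n (x : A) s : ncons n x (x :: s) = ncons n.+1 x s.
Proof. by elim: n => //= n ->. Qed.

(** There is one node more than there are letters; the default of [nth] leaves this last node
    uncoloured. *)
Definition path_graph (w : seq bool) : fgraph unit unit :=
  {| forder := (size w).+1;
     fedge := fun u _ v => v == u.+1 :> nat;
     flabel := fun v => if nth false w v then setT else set0;
     froot := ord0 |}.

Inductive path_state := PScan | PSep | PRow | PZeros | PBack | PCopy | PRewind.

Definition path_state_code (q : path_state) : 'I_7 :=
  inord match q with
        | PScan => 0 | PSep => 1 | PRow => 2 | PZeros => 3 | PBack => 4
        | PCopy => 5 | PRewind => 6
        end.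

Definition path_state_decode (i : 'I_7) : option path_state :=
  nth None [seq Some q | q <- [:: PScan; PSep; PRow; PZeros; PBack; PCopy; PRewind]] i.

Lemma path_state_codeK : pcancel path_state_code path_state_decode.
Proof. by case; rewrite /path_state_decode inordK. Qed.

HB.instance Definition _ := Finite.copy path_state (pcan_type path_state_codeK).

(** Tapes: the input [w], a unary copy of its length, and the output, which is
    [1^(m+1) 0 (1 0^(m+1))^(m+1) w 0] for [m = size w]: the root vector
    [1 0^m] followed by the first zero of the adjacency matrix is [1 0^(m+1)],
    and so is every stretch of the matrix from one superdiagonal entry up to
    the next. *)
Definition path_delta (q : path_state) (s : seq symb) :
    option (option path_state * seq action) :=
  match q, s with
  | PScan, [:: Some _; _; _] =>
      Some (Some PScan, [:: goR; putR true; putR true])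
  | PScan, _ => Some (Some PSep, [:: goL; keep; putR true])
  | PSep, _ => Some (Some PRow, [:: keep; keep; putR false])
  | PRow, _ => Some (Some PZeros, [:: keep; goL; putR true])
  | PZeros, [:: _; Some _; _] =>
      Some (Some PZeros, [:: keep; goL; putR false])
  | PZeros, _ => Some (Some PBack, [:: keep; goR; putR false])
  | PBack, [:: _; Some _; _] => Some (Some PBack, [:: keep; goR; keep])
  | PBack, [:: Some _; _; _] => Some (Some PRow, [:: goL; keep; keep])
  | PBack, _ => Some (Some PCopy, [:: goR; keep; keep])
  | PCopy, [:: Some b; _; _] => Some (Some PCopy, [:: goR; keep; putR b])
  | PCopy, _ => Some (Some PRewind, [:: keep; keep; put false])
  | PRewind, [:: _; _; Some _] => Some (Some PRewind, [:: keep; keep; goL])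
  | PRewind, _ => Some (None, [:: keep; keep; goR])
  end.

Definition path_transducer : transducer :=
  {| tstate := path_state; aux_tapes := 1; tstart := PScan; delta := path_delta |}.

Local Notation path_out := (@outcome path_transducer).

Ltac tstep := apply: OutcomeStep; [reflexivity | rewrite /= /zact /=].

(** Loops are described in continuation form: an outcome from the configuration after the loop gives
    one from before it, so phases chain by [apply]. Here [n] is the number of marks made so far and
    [lo] the output so far, reversed. *)
Lemma path_scan w t r lx n lo :
  path_out t (Some PSep)
    [:: zmove MoveLeft (catrev (bits w) lx, [::]);
        (bits (ncons (size w + n) true [::]) ++ [:: None], [::]);
        (bits (ncons (size w).+1 true lo) ++ [:: None], [::])] r ->
  path_out ((size w).+1 + t) (Some PScan)
    [:: (lx, bits w); (bits (ncons n true [::]) ++ [:: None], [::]);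
        (bits lo ++ [:: None], [::])] r.
Proof.
elim: w lx n lo => [|b w IH] lx n lo H; first by tstep.
tstep; apply: (IH _ n.+1 (true :: lo)).
by rewrite addnS ncons_cons.
Qed.

(** The blank met to the left of the [m] marks contributes the last of the [m.+1] zeros. *)
Lemma path_zeros x m t r rt lo :
  path_out t (Some PBack)
    [:: x; ([:: None], bits (ncons m true rt));
        (bits (ncons m.+1 false lo) ++ [:: None], [::])] r ->
  path_out (m.+1 + t) (Some PZeros)
    [:: x; zmove MoveLeft (bits (ncons m true [::]) ++ [:: None], bits rt);
        (bits lo ++ [:: None], [::])] r.
Proof.
elim: m rt lo => [|m IH] rt lo H.
  by apply: OutcomeStep; first by case: (zread x).
apply: OutcomeStep; first by rewrite /=; case: (zread x).
rewrite /zact /=; apply: (IH (true :: rt) (false :: lo)).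
by rewrite !ncons_cons.
Qed.

Definition marks m : zipper := (bits (ncons m true [::]) ++ [:: None], [::]).

Lemma path_back x m n t r o :
  (forall t', path_out (t + t') (Some PBack) [:: x; marks (m + n); o] r) ->
  path_out (m + t) (Some PBack)
    [:: x; (bits (ncons n true [::]) ++ [:: None], bits (ncons m true [::])); o] r.
Proof.
move=> H; elim: m n H => [|m IH] n H; first by have := H 0; rewrite addn0.
apply: OutcomeStep; first by rewrite /=; case: (zread x).
by rewrite /zact /=; apply: (IH n.+1) => t'; rewrite -addSnnS.
Qed.

(** Appends [1 0^(m+1)] to an output that is kept in reverse. *)
Definition row_block m lo := ncons m.+1 false (true :: lo).

Lemma path_row c m lx rx t r lo :
  (if c is Some b then
     path_out t (Some PRow)
       [:: zmove MoveLeft (lx, Some b :: rx); marks m;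
           (bits (row_block m lo) ++ [:: None], [::])] r
   else
     path_out t (Some PCopy)
       [:: (None :: lx, rx); marks m;
           (bits (row_block m lo) ++ [:: None], [::])] r) ->
  path_out (m.*2 + 3 + t) (Some PRow)
    [:: (lx, c :: rx); marks m; (bits lo ++ [:: None], [::])] r.
Proof.
move=> H; have -> : m.*2 + 3 + t = (m.+1 + (m + t.+1)).+1 by lia.
tstep; rewrite /marks; apply: (path_zeros (lo := true :: lo) (rt := [::])).
apply: (@path_back _ m 0) => t'; rewrite addn0 addSn.
by case: c H => [b|] H; tstep; apply: outcome_le H; apply: leq_addr.
Qed.

(** The input tape is the loop counter: its head walks from the last letter to the blank before the
    first, which gives one block per letter and one more. *)
Lemma path_rows v u m t r lo :
  path_out t (Some PCopy)
    [:: ([:: None], bits (catrev v u)); marks m;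
        (bits (iter (size v).+1 (row_block m) lo) ++ [:: None], [::])] r ->
  path_out ((size v).+1 * (m.*2 + 3) + t) (Some PRow)
    [:: zmove MoveLeft (bits v ++ [:: None], bits u); marks m;
        (bits lo ++ [:: None], [::])] r.
Proof.
elim: v u lo => [|b v IH] u lo H; first by rewrite mul1n; apply: path_row.
rewrite mulSn -addnA; apply: path_row; apply: (IH (b :: u)); by rewrite -iterSr.
Qed.

Lemma path_copy w lx tp t r lo :
  path_out t (Some PRewind)
    [:: (catrev (bits w) lx, [::]); tp;
        (bits (catrev w lo) ++ [:: None], [:: Some false])] r ->
  path_out ((size w).+1 + t) (Some PCopy)
    [:: (lx, bits w); tp; (bits lo ++ [:: None], [::])] r.
Proof.
elim: w lx lo => [|b w IH] lx lo H; first by tstep.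
by tstep; apply: (IH _ (b :: lo)).
Qed.

Lemma path_rewind x tp lo w :
  path_out (size lo).+2 (Some PRewind)
    [:: x; tp; zmove MoveLeft (bits lo ++ [:: None], bits w)] (Some (catrev lo w)).
Proof.
elim: lo w => [|b lo IH] w.
  apply: OutcomeStep; first by rewrite /=; case: (zread x); case: (zread tp).
  by apply: (@OutcomeExit _ _ _ [:: None]) => // -[|k] //=; rewrite nth_nil.
apply: OutcomeStep; first by rewrite /=; case: (zread x); case: (zread tp).
exact: (IH (b :: w)).
Qed.

Definition path_word w :=
  let m := size w in
  catrev (catrev w (iter m.+1 (row_block m) (false :: ncons m.+1 true [::])))
    [:: false].

Lemma flatten_nseqSr (A : Type) n (c : seq A) :
  flatten (nseq n c) ++ c = flatten (nseq n.+1 c).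
Proof. by elim: n => [|n IH]; rewrite /= ?cats0 // -catA IH. Qed.

Lemma path_wordE w : path_word w =
  nseq (size w).+1 true ++ false ::
  flatten (nseq (size w).+1 (true :: nseq (size w).+1 false)) ++ rcons w false.
Proof.
have rev_ncons n (a : bool) s : rev (ncons n a s) = rev s ++ nseq n a.
  by rewrite -cat_nseq rev_cat rev_nseq.
have rev_rows n m s : rev (iter n (row_block m) s) =
    rev s ++ flatten (nseq n (true :: nseq m.+1 false)).
  elim: n => [|n IH]; first by rewrite cats0.
  rewrite iterS rev_ncons rev_cons IH cat_rcons -catA; congr (_ ++ _).
  exact: flatten_nseqSr.
rewrite /path_word !catrevE rev_cat revK rev_rows rev_cons rev_ncons.
by rewrite [rev [::]]/= cat0s -!catA cat_rcons cats1.
Qed.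

Lemma size_path_word w : size (path_word w) = (size w).+2 + (size w).+1 * (size w).+3.
Proof.
have size_cons (a : bool) s : size (a :: s) = (size s).+1 by [].
rewrite path_wordE size_cat size_nseq size_cons size_cat size_rcons size_flatten.
rewrite /shape map_nseq sumn_nseq /= size_nseq; lia.
Qed.

Lemma path_transducer_outcome w :
  path_out (20 * (size w).+1 ^ 3) (Some PScan) (tinit path_transducer w)
    (Some (path_word w)).
Proof.
pose m := size w.
pose lo := catrev w (iter m.+1 (row_block m) (false :: ncons m.+1 true [::])).
have size_lo : size lo = m.+1 + m.+1 * m.+3.
  have := size_path_word w; rewrite /path_word -/m -/lo catrevE size_cat size_rev /=.
  by lia.
(* The summands are the durations of the scan, the separator, the blocks, the copy, the first step
   back and the rest of the rewinding. *)
apply: (@outcome_le _ (m.+1 + (1 + (m.+1 * (m.*2 + 3) + (m.+1 + (1 + (size lo).+2)))))).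
  by rewrite size_lo !expnS expn0; nia.
apply: (@path_scan w _ _ _ 0 [::]); rewrite addn0.
rewrite catrevE -map_rev; tstep.
have := @path_rows (rev w) [::] m _ _ (false :: ncons m.+1 true [::]); rewrite size_rev catrevE revK cats0; apply.
by apply: path_copy; tstep; apply: (path_rewind _ _ _ [:: false]).
Qed.

(** * The encoding of a path, bit by bit *)

Lemma map_enum_ord (A : Type) (f : nat -> A) n :
  [seq f i | i : 'I_n <- enum 'I_n] = mkseq f n.
Proof. by rewrite /mkseq -val_enum_ord -map_comp. Qed.

Lemma enum_unit : enum {: unit} = [:: tt].
Proof. by rewrite enumT unlock. Qed.

Lemma encode_unit (G : fgraph unit unit) : encode G =
  nseq (forder G) true ++ false ::
  [seq v == froot G | v <- enum 'I_(forder G)] ++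
  flatten [seq [seq fedge u tt v | v <- enum 'I_(forder G)] | u <- enum 'I_(forder G)] ++
  [seq tt \in flabel v | v <- enum 'I_(forder G)].
Proof. by rewrite /encode enum_unit /= !cats0. Qed.

Lemma mkseq_eq n i :
  mkseq (fun v => v == i) n =
  if i < n then nseq i false ++ true :: nseq (n - i.+1) false else nseq n false.
Proof.
apply: (@eq_from_nth _ false).
  by case: ifP => lt_i; rewrite ?size_cat /= !size_nseq // size_mkseq //; lia.
move=> v; rewrite size_mkseq => lt_v; rewrite nth_mkseq //.
case: ifP => lt_i; last by rewrite nth_nseq lt_v; lia.
rewrite nth_cat size_nseq nth_nseq; case: ltngtP => [||->] //; last by rewrite subnn.
by move=> lt_iv; rewrite -[v - i]prednK /= ?subn_gt0 // nth_nseq if_same.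
Qed.

(** Read row by row, consecutive ones of the superdiagonal are separated by as many zeros as a row
    has entries. The leading [nseq j false] is what follows the one in row [i - 1]; the width
    [i + j + 1] stays fixed in the induction. *)
Lemma superdiagonal j i :
  nseq j false ++
    flatten [seq mkseq (fun v => v == u.+1) (i + j).+1 | u <- iota i j.+1] =
  nseq (i + j).+1 false ++ flatten (nseq j (true :: nseq (i + j).+1 false)).
Proof.
have fl (A : Type) (x : seq A) s : flatten (x :: s) = x ++ flatten s by [].
elim: j i => [|j IH] i.
  have e : iota i 1 = [:: i] by [].
  by rewrite e map_cons fl addn0 mkseq_eq ltnn !cats0.
have e : iota i j.+2 = i :: iota i.+1 j.+1 by [].
rewrite e map_cons.
have lt_i : i.+1 < (i + j.+1).+1 by lia.
rewrite fl mkseq_eq lt_i.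
rewrite -catA catA -nseqD cat_cons.
have -> : (i + j.+1).+1 - i.+2 = j by lia.
have := IH i.+1; rewrite addSnnS => ->.
have f2 (A : Type) n (x : seq A) : flatten (nseq n.+1 x) = x ++ flatten (nseq n x) by [].
by rewrite f2 cat_cons; congr (nseq _ _ ++ _); lia.
Qed.

Lemma encode_path w : encode (path_graph w) = path_word w.
Proof.
rewrite encode_unit path_wordE; set m := size w.
have -> : [seq v == froot (path_graph w) | v <- enum 'I_(forder (path_graph w))] =
    true :: nseq m false.
  by rewrite (map_enum_ord (fun v => v == 0) m.+1) mkseq_eq /= subn1.
have -> : [seq tt \in flabel v | v <- enum 'I_(forder (path_graph w))] = rcons w false.
  transitivity (mkseq (nth false (rcons w false)) m.+1).
    rewrite -map_enum_ord; apply: eq_map => v.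
    rewrite nth_rcons_default [flabel v]/=; case: (nth false w v).
      exact: in_setT.
    exact: in_set0.
  by have := mkseq_nth false (rcons w false); rewrite size_rcons.
have -> : [seq [seq fedge u tt v | v <- enum 'I_(forder (path_graph w))]
            | u <- enum 'I_(forder (path_graph w))]
    = [seq mkseq (fun v => v == u.+1) (0 + m).+1 | u <- iota 0 m.+1].
  rewrite -[RHS]/(mkseq _ _) -map_enum_ord; apply: eq_map => u.
  by rewrite -map_enum_ord.
(* The root vector [1 0^m] acts as a row preceding row 0; its zeros are the prefix required here. *)
have := superdiagonal m 0; rewrite add0n catA cat_cons => ->.
have f2 (A : Type) n (x : seq A) : flatten (nseq n.+1 x) = x ++ flatten (nseq n x) by [].
by rewrite f2 -cat_cons.
Qed.

(** * From encodings of graphs to words *)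

Inductive read_state :=
  | ROnes | RBackOnes | RRoot of bool | RBackRoot | RRow | RIn of bool
  | RBackNext | RBackRows | RColour of bool | RBackInput | RBackColour
  | RCopy of bool | RBackCopy | ROutput.

Definition read_state_code (q : read_state) : 'I_14 * bool :=
  match q with
  | ROnes => (inord 0, false) | RBackOnes => (inord 1, false)
  | RRoot b => (inord 2, b) | RBackRoot => (inord 3, false)
  | RRow => (inord 4, false) | RIn b => (inord 5, b)
  | RBackNext => (inord 6, false) | RBackRows => (inord 7, false)
  | RColour b => (inord 8, b) | RBackInput => (inord 9, false)
  | RBackColour => (inord 10, false) | RCopy b => (inord 11, b)
  | RBackCopy => (inord 12, false) | ROutput => (inord 13, false)
  end.

Definition read_state_decode (c : 'I_14 * bool) : option read_state :=
  let: (i, b) := c in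
  nth None [seq Some q | q <- [:: ROnes; RBackOnes; RRoot b; RBackRoot; RRow;
    RIn b; RBackNext; RBackRows; RColour b; RBackInput; RBackColour; RCopy b;
    RBackCopy; ROutput]] i.

Lemma read_state_codeK : pcancel read_state_code read_state_decode.
Proof. by case=> *; rewrite /read_state_decode /= inordK. Qed.

HB.instance Definition _ := Finite.copy read_state (pcan_type read_state_codeK).

Notation eraseR := (Some None, MoveRight).
Notation eraseL := (Some None, MoveLeft).

(** Tapes: the input, the indicator vectors of the current level and of the part
    of the next level found so far, a unary counter of the levels still allowed,
    and the output.  The order and the root vector are erased from the input, so
    that the adjacency matrix is preceded by a blank and each level is one pass
    over the rest of the input. *)
Definition read_delta (q : read_state) (s : seq symb) :
    option (option read_state * seq action) :=
  match q, s with
  | ROnes, [:: Some true; _; _; _; _] =>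
      Some (Some ROnes, [:: eraseR; putR false; putR false; putR true; keep])
  | ROnes, [:: Some false; _; _; _; _] =>
      Some (Some RBackOnes, [:: eraseR; goL; goL; goL; keep])
  | RBackOnes, [:: _; Some _; _; _; _] =>
      Some (Some RBackOnes, [:: keep; goL; goL; goL; keep])
  | RBackOnes, _ => Some (Some (RRoot false), [:: keep; goR; goR; goR; keep])
  | RRoot f, [:: Some b; Some _; _; _; _] =>
      if f && b then None
      else Some (Some (RRoot (f || b)), [:: eraseR; putR b; keep; keep; keep])
  | RRoot true, [:: _; None; _; _; _] =>
      Some (Some RBackRoot, [:: keep; goL; keep; keep; keep])
  | RBackRoot, [:: _; Some _; _; _; _] =>
      Some (Some RBackRoot, [:: keep; goL; keep; keep; keep])
  | RBackRoot, _ => Some (Some RRow, [:: keep; goR; keep; keep; keep])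
  | RRow, [:: _; Some u; _; _; _] =>
      Some (Some (RIn u), [:: keep; keep; keep; keep; keep])
  | RRow, _ => Some (Some RBackRows, [:: keep; goL; keep; keep; keep])
  | RIn u, [:: Some b; _; Some c; _; _] =>
      Some (Some (RIn u), [:: goR; keep; putR (c || u && b); keep; keep])
  | RIn u, [:: _; _; None; _; _] =>
      Some (Some RBackNext, [:: keep; keep; goL; keep; keep])
  | RBackNext, [:: _; _; Some _; _; _] =>
      Some (Some RBackNext, [:: keep; keep; goL; keep; keep])
  | RBackNext, _ => Some (Some RRow, [:: keep; goR; goR; keep; keep])
  | RBackRows, [:: _; Some _; _; _; _] =>
      Some (Some RBackRows, [:: keep; goL; keep; keep; keep])
  | RBackRows, _ => Some (Some (RColour false), [:: keep; goR; keep; keep; keep])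
  | RColour f, [:: Some b; Some u; _; _; _] =>
      Some (Some (RColour (f || u && b)), [:: goR; goR; keep; keep; keep])
  | RColour f, [:: None; None; _; Some _; _] =>
      Some (Some RBackInput, [:: goL; goL; keep; goR; put f])
  | RBackInput, [:: Some _; _; _; _; _] =>
      Some (Some RBackInput, [:: goL; keep; keep; keep; keep])
  | RBackInput, _ => Some (Some RBackColour, [:: goR; keep; keep; keep; keep])
  | RBackColour, [:: _; Some _; _; _; _] =>
      Some (Some RBackColour, [:: keep; goL; keep; keep; keep])
  | RBackColour, _ => Some (Some (RCopy false), [:: keep; goR; keep; keep; keep])
  | RCopy f, [:: _; _; Some b; _; _] =>
      Some (Some (RCopy (f || b)), [:: keep; putR b; putR false; keep; keep])
  | RCopy true, _ => Some (Some RBackCopy, [:: keep; goL; goL; keep; goR])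
  | RCopy false, _ => Some (Some ROutput, [:: keep; keep; keep; keep; eraseL])
  | RBackCopy, [:: _; Some _; _; _; _] =>
      Some (Some RBackCopy, [:: keep; goL; goL; keep; keep])
  | RBackCopy, _ => Some (Some RRow, [:: keep; goR; goR; keep; keep])
  | ROutput, [:: _; _; _; _; Some _] =>
      Some (Some ROutput, [:: keep; keep; keep; keep; goL])
  | ROutput, _ => Some (None, [:: keep; keep; keep; keep; goR])
  | _, _ => None
  end.

Definition read_transducer : transducer :=
  {| tstate := read_state; aux_tapes := 3; tstart := ROnes; delta := read_delta |}.

Local Notation read_out := (@outcome read_transducer).
Notation tape p l y := (bits l ++ None :: p, bits y).
Notation back z := (zmove MoveLeft z).

(* The symbols on the other tapes must be exposed for the transition to compute. *)
Ltac read_tapes :=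
  rewrite /=; repeat (match goal with
    | |- context [zread ?z] => is_var z; case: (zread z) => [[]|]
    | |- context [head None (@map _ _ _ ?y)] => is_var y; case: (y) => [|[] ?]
    | |- context [zread (_, @map _ _ _ ?y)] => is_var y; case: (y) => [|[] ?]
    end); reflexivity.
Ltac rstep := apply: OutcomeStep; [by read_tapes | rewrite /= /zact /=].
Ltac rstuck := apply: OutcomeStuck; by read_tapes.

(** * Single passes of the reading machine over its tapes *)

Section Passes.
Variables (t : nat) (r : option (seq bool)).
Implicit Types (x s n c o : zipper) (p px ps pn pc : seq symb).
Implicit Types (l y lx ls ln lc ys yn yc v row z : seq bool) (f u b : bool).

(** Only one of the three tapes is tested, so equal lengths are what brings all three heads to their
    left ends together. *)
Lemma back_ones x o ps ls ys pn ln yn pc lc yc :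
  size ls = size ln -> size ls = size lc ->
  read_out t (Some (RRoot false)) [:: x; tape ps [::] (catrev ls ys);
    tape pn [::] (catrev ln yn); tape pc [::] (catrev lc yc); o] r ->
  read_out ((size ls).+1 + t) (Some RBackOnes)
    [:: x; back (tape ps ls ys); back (tape pn ln yn); back (tape pc lc yc); o] r.
Proof.
elim: ls ln lc ys yn yc => [|b ls IH] [|b' ln] [|b'' lc] //= ys yn yc.
  by move=> _ _ H; rstep.
by move=> [e1] [e2] H; rstep; apply: (IH _ _ (b :: ys) (b' :: yn) (b'' :: yc)).
Qed.

Lemma back_root x n c o p l y :
  read_out t (Some RRow) [:: x; tape p [::] (catrev l y); n; c; o] r ->
  read_out ((size l).+1 + t) (Some RBackRoot) [:: x; back (tape p l y); n; c; o] r.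
Proof.
elim: l y => [|b l IH] y H; first by rstep.
by rstep; apply: (IH (b :: y)).
Qed.

Lemma back_next x p' l' b y' c o p l y :
  read_out t (Some RRow)
    [:: x; tape p' (b :: l') y'; tape p [::] (catrev l y); c; o] r ->
  read_out ((size l).+1 + t) (Some RBackNext)
    [:: x; tape p' l' (b :: y'); back (tape p l y); c; o] r.
Proof.
elim: l y => [|b' l IH] y H; first by rstep.
by rstep; apply: (IH (b' :: y)).
Qed.

Lemma back_rows x n c o p l y :
  read_out t (Some (RColour false)) [:: x; tape p [::] (catrev l y); n; c; o] r ->
  read_out ((size l).+1 + t) (Some RBackRows) [:: x; back (tape p l y); n; c; o] r.
Proof.
elim: l y => [|b l IH] y H; first by rstep.
by rstep; apply: (IH (b :: y)).
Qed.

Lemma back_input s n c o p l y :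
  read_out t (Some RBackColour) [:: tape p [::] (catrev l y); s; n; c; o] r ->
  read_out ((size l).+1 + t) (Some RBackInput) [:: back (tape p l y); s; n; c; o] r.
Proof.
elim: l y => [|b l IH] y H; first by rstep.
by rstep; apply: (IH (b :: y)).
Qed.

Lemma back_colour x n c o p l y :
  read_out t (Some (RCopy false)) [:: x; tape p [::] (catrev l y); n; c; o] r ->
  read_out ((size l).+1 + t) (Some RBackColour) [:: x; back (tape p l y); n; c; o] r.
Proof.
elim: l y => [|b l IH] y H; first by rstep.
by rstep; apply: (IH (b :: y)).
Qed.

Lemma back_copy x c o ps ls ys pn ln yn :
  size ls = size ln ->
  read_out t (Some RRow) [:: x; tape ps [::] (catrev ls ys);
    tape pn [::] (catrev ln yn); c; o] r ->
  read_out ((size ls).+1 + t) (Some RBackCopy)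
    [:: x; back (tape ps ls ys); back (tape pn ln yn); c; o] r.
Proof.
elim: ls ln ys yn => [|b ls IH] [|b' ln] //= ys yn; first by move=> _ H; rstep.
by move=> [e] H; rstep; apply: (IH _ (b :: ys) (b' :: yn)).
Qed.

Lemma read_ones k y px ps ls pn ln pc lc o :
  read_out t (Some RBackOnes)
    [:: (None :: ncons k None px, bits y);
        back (tape ps (ncons k false ls) [::]); back (tape pn (ncons k false ln) [::]);
        back (tape pc (ncons k true lc) [::]); o] r ->
  read_out (k.+1 + t) (Some ROnes)
    [:: (px, bits (nseq k true ++ false :: y)); tape ps ls [::]; tape pn ln [::];
        tape pc lc [::]; o] r.
Proof.
elim: k px ls ln lc => [|k IH] px ls ln lc H; first by rstep.
by rstep; apply: (IH (None :: px) (false :: ls) (false :: ln) (true :: lc));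
  rewrite !ncons_cons.
Qed.

Lemma read_root f v z px ps ls ys n c o :
  size v = size ys -> f + count id v = 1 ->
  (forall px', read_out t (Some RBackRoot)
    [:: tape px' [::] z; back (tape ps (catrev v ls) [::]); n; c; o] r) ->
  read_out ((size v).+1 + t) (Some (RRoot f))
    [:: tape px [::] (v ++ z); tape ps ls ys; n; c; o] r.
Proof.
elim: v f px ls ys => [|b v IH] f px ls [|y ys] //=.
  by case: f => // _ _ H; rstep; apply: H.
case: f => -[e] ef H; first case: b ef H => // ef H.
  apply: OutcomeStep; first by [].
  by apply: (IH true (None :: px) (false :: ls)).
apply: OutcomeStep; first by [].
by apply: (IH b (None :: px) (b :: ls)).
Qed.

Lemma read_row u row z px lx s pn ln yn c o :
  size row = size yn ->
  read_out t (Some RBackNext)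
    [:: tape px (catrev row lx) z; s;
        back (tape pn (catrev [seq q.1 || u && q.2 | q <- zip yn row] ln) [::]); c; o] r ->
  read_out ((size row).+1 + t) (Some (RIn u))
    [:: tape px lx (row ++ z); s; tape pn ln yn; c; o] r.
Proof.
elim: row lx ln yn => [|b row IH] lx ln [|y yn] //=; first by move=> _ H; rstep.
by move=> [e] H; rstep; apply: (IH (b :: lx) (_ :: ln)).
Qed.

Lemma read_colour f v px lx ps ls ys n pc lc b yc lo :
  size v = size ys ->
  read_out t (Some RBackInput)
    [:: back (tape px (catrev v lx) [::]); back (tape ps (catrev ys ls) [::]); n;
        tape pc (b :: lc) yc;
        (lo, [:: Some (f || has (fun q => q.1 && q.2) (zip ys v))])] r ->
  read_out ((size v).+1 + t) (Some (RColour f))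
    [:: tape px lx v; tape ps ls ys; n; tape pc lc (b :: yc); (lo, [::])] r.
Proof.
elim: v f lx ls ys => [|a v IH] f lx ls [|y ys] //=.
  by move=> _ H; rstep; rewrite orbF in H.
by move=> [e]; rewrite orbA => H; rstep; apply: (IH _ (a :: lx) (y :: ls)).
Qed.

(** The copy doubles as an emptiness test. The colour of the current level already stands under the
    output head; it is kept as a letter if there is a further level and erased otherwise. *)
Lemma read_copy f x ps ls ys pn ln yn c o :
  size ys = size yn ->
  (if f || has id yn then
    read_out t (Some RBackCopy)
      [:: x; back (tape ps (catrev yn ls) [::]);
          back (tape pn (ncons (size yn) false ln) [::]); c; zact goR o] r
   else
    read_out t (Some ROutput)
      [:: x; tape ps (catrev yn ls) [::];
          tape pn (ncons (size yn) false ln) [::]; c; zact eraseL o] r) ->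
  read_out ((size yn).+1 + t) (Some (RCopy f))
    [:: x; tape ps ls ys; tape pn ln yn; c; o] r.
Proof.
elim: yn f ls ln ys => [|b yn IH] f ls ln [|y ys] //=.
  by rewrite orbF; case: f => _ H; apply: OutcomeStep => //.
move=> [e]; rewrite orbA; case: f => H; rstep.
  by apply: (IH true (b :: ls) (false :: ln)); rewrite // ncons_cons.
by apply: (IH b (b :: ls) (false :: ln)); rewrite // ncons_cons.
Qed.

End Passes.

Definition merge_row (u : bool) (v row : seq bool) : seq bool :=
  [seq q.1 || u && q.2 | q <- zip v row].

(** The Boolean product of the row vector [s] with the matrix, joined to [v]. *)
Fixpoint merge_rows (s : seq bool) (rows : seq (seq bool)) (v : seq bool) :=
  match s, rows with
  | u :: s', row :: rows' => merge_rows s' rows' (merge_row u v row)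
  | _, _ => v
  end.

Lemma size_merge_row u v row : size row = size v -> size (merge_row u v row) = size v.
Proof. by move=> e; rewrite size_map size_zip e minnn. Qed.

Lemma catrevK (A : Type) (s : seq A) : catrev (catrev s [::]) [::] = s.
Proof. by rewrite !catrevE !cats0 revK. Qed.

Section Levels.
Implicit Types (x s n c o : zipper) (p px ps pn pc : seq symb).
Implicit Types (l y lx ls ln lc ys yn yc v row z : seq bool) (f u b : bool).

Lemma read_rows t r (s : seq bool) rows z px lx ps ls pn v c o :
  size s = size rows -> all (fun row => size row == size v) rows ->
  read_out t (Some RBackRows)
    [:: tape px (catrev (flatten rows) lx) z; back (tape ps (catrev s ls) [::]);
        tape pn [::] (merge_rows s rows v); c; o] r ->
  read_out (size s * ((size v).*2 + 3) + t.+1) (Some RRow)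
    [:: tape px lx (flatten rows ++ z); tape ps ls s; tape pn [::] v; c; o] r.
Proof.
elim: s rows lx ls v => [|u s IH] [|row rows] lx ls v //=; first by move=> _ _ H; rstep.
move=> [e] /andP[/eqP erow erows] H.
apply: (@outcome_le _ ((size row).+1 + ((size v).+1 +
          (size s * ((size v).*2 + 3) + t.+1))).+1); first by rewrite mulSn; lia.
rstep; rewrite -catA; apply: (@read_row _ _ _ _ _ _ _ _ _ [::]) => //.
rewrite -/(merge_row u v row) -{1}(size_merge_row u erow).
have -> : size (merge_row u v row) = size (catrev (merge_row u v row) [::]).
  by rewrite catrevE cats0 size_rev.
apply: back_next; rewrite catrevK.
rewrite -{1}(size_merge_row u erow); apply: IH => //.
  by rewrite size_merge_row.
by move: H; rewrite !catrevE rev_cat -catA.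
Qed.

Lemma read_row_stuck u y px lx s pn ln yn c o :
  size y < size yn ->
  read_out (size yn).+1 (Some (RIn u))
    [:: tape px lx y; s; tape pn ln yn; c; o] None.
Proof.
elim: y lx ln yn => [|b y IH] lx ln [|a yn] //= lt_y; first by rstuck.
by rstep; apply: (IH (b :: lx) (_ :: ln)).
Qed.

Lemma read_rows_stuck (s : seq bool) y px lx ps ls pn v c o :
  size y < size s * size v ->
  read_out (size s * ((size v).*2 + 3)) (Some RRow)
    [:: tape px lx y; tape ps ls s; tape pn [::] v; c; o] None.
Proof.
elim: s y lx ls v => [|u s IH] y lx ls v //=; rewrite mulSn => lt_y.
case: (ltnP (size y) (size v)) => [lt_yv|le_vy].
  apply: (@outcome_le _ (size v).+2); first by rewrite mulSn; lia.
  by rstep; apply: (@read_row_stuck _ _ _ _ _ _ [::]).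
have erow : size (take (size v) y) = size v by rewrite size_takel.
rewrite -(cat_take_drop (size v) y) mulSn; move: (take _ _) erow => row erow.
apply: (@outcome_le _ ((size row).+1 + ((size v).+1 +
          (size s * ((size v).*2 + 3)))).+1); first by lia.
rstep; apply: (@read_row _ _ _ _ _ _ _ _ _ [::]) => //.
rewrite -/(merge_row u v row) -{1}(size_merge_row u erow).
have -> : size (merge_row u v row) = size (catrev (merge_row u v row) [::]).
  by rewrite catrevE cats0 size_rev.
apply: back_next; rewrite catrevK.
rewrite -{1}(size_merge_row u erow); apply: IH.
by rewrite size_merge_row // size_drop; lia.
Qed.

(** This state is where two kinds of input are rejected: a colour vector of wrong length, as one
    tape ends before the other, and an exhausted level counter. *)
Lemma read_colour_stuck f v px lx ps ls ys n c o :
  (size v != size ys) || (zread c == None) ->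
  read_out (size ys).+1 (Some (RColour f)) [:: tape px lx v; tape ps ls ys; n; c; o] None.
Proof.
elim: v f lx ls ys => [|a v IH] f lx ls [|y ys] /= H.
- by apply: OutcomeStuck; rewrite /= (eqP H).
- by rstuck.
- by rstuck.
by rstep; apply: (IH _ (a :: lx) (y :: ls)).
Qed.

(** The right side [rt] is given by its cells only, since the erased last letter leaves an explicit
    blank there. *)
Lemma read_output x s n c p lo (rt : seq symb) y :
  (forall k, nth None p k = None) ->
  (forall k, nth None rt k = nth None (bits y) k) ->
  read_out (size lo).+2 (Some ROutput)
    [:: x; s; n; c; back (bits lo ++ None :: p, rt)] (Some (catrev lo y)).
Proof.
move=> hp; elim: lo rt y => [|b lo IH] rt y hy.
  by rstep; apply: (@OutcomeExit _ _ _ (None :: p)) => // -[].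
by rstep; apply: (IH _ (b :: y)) => -[|k] //=.
Qed.

End Levels.

(** * Computing one level from the previous one *)

Section OneLevel.
Variables (k : nat) (rows : seq (seq bool)) (cols : seq bool).
Hypotheses (size_rows : size rows = k) (size_row : all (fun row => size row == k) rows).
Implicit Types (v lc yc lo : seq bool) (px ps pn pc : seq symb).

Definition level_tapes px ps pn pc v lc yc lo : seq zipper :=
  [:: tape px [::] (flatten rows ++ cols); tape ps [::] v;
      tape pn [::] (nseq k false); tape pc lc yc;
      (bits lo ++ [:: None], [::])].

Definition next_level v := merge_rows v rows (nseq k false).
Definition level_colour v := has (fun q => q.1 && q.2) (zip v cols).
(** Each of the [k] rows costs [2k + 3] steps, for its entries and the way back on the next-level
    tape, and rewinding the input costs about [k^2 + k]; the constant leaves room for the linear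
    passes. *)
Definition level_time := 9 * k.+1 ^ 2.

Lemma size_flatten_rows : size (flatten rows) = k * k.
Proof.
rewrite size_flatten /shape -{1}size_rows; elim: rows size_row => //= row l IH.
by case/andP=> /eqP-> /IH ->; rewrite mulSn.
Qed.

Lemma size_next_level v : size (next_level v) = k.
Proof.
rewrite /next_level; have : size (nseq k false) = k by rewrite size_nseq.
elim: v rows (nseq k false) size_row => [|u v IH] [|row l] w //= /andP[/eqP er el] ew.
by apply: IH => //; rewrite size_merge_row // ew.
Qed.

Lemma read_to_colour t r v px ps pn pc lc yc lo : size v = k ->
  read_out t (Some (RColour false))
    [:: tape px (catrev (flatten rows) [::]) cols; tape ps [::] v;
        tape pn [::] (next_level v); tape pc lc yc; (bits lo ++ [:: None], [::])] r ->
  read_out (k * (k.*2 + 3) + (k.+1 + t).+1) (Some RRow)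
    (level_tapes px ps pn pc v lc yc lo) r.
Proof.
move=> ev H; rewrite -{1}ev -{1}(size_nseq k false).
apply: (@read_rows _ _ _ _ _ _ [::] _ [::]); first by rewrite ev.
  by rewrite size_nseq.
have e : size (catrev v [::]) = k by rewrite catrevE cats0 size_rev.
by rewrite -{1}e; apply: back_rows; rewrite catrevK.
Qed.

Lemma read_level t r v px ps pn pc lc yc lo :
  size v = k -> size cols = k ->
  (if has id (next_level v) then
    read_out t (Some RRow)
      (level_tapes px ps pn pc (next_level v) (true :: lc) yc (level_colour v :: lo)) r
   else r = Some (rev lo) /\ (size lo).+2 <= t) ->
  read_out (level_time + t) (Some RRow) (level_tapes px ps pn pc v lc (true :: yc) lo) r.
Proof.
move=> ev ec H.
apply: (@outcome_le _ (k * (k.*2 + 3) + (k.+1 + (k.+1 + ((k * k + k).+1 +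
  (k.+1 + (k.+1 + (k.+1 + t)))))).+1)).
  by rewrite /level_time !expnS expn0; nia.
apply: read_to_colour => //; rewrite -{1}ec.
apply: read_colour; first by rewrite ec.
have e1 : size (catrev cols (catrev (flatten rows) [::])) = k * k + k.
  by rewrite !catrevE cats0 size_cat !size_rev size_flatten_rows ec addnC.
rewrite -e1; apply: back_input.
have -> : catrev (catrev cols (catrev (flatten rows) [::])) [::] = flatten rows ++ cols.
  by rewrite !catrevE !cats0 rev_cat !revK.
have e2 : size (catrev v [::]) = k by rewrite catrevE cats0 size_rev.
rewrite -{1}e2; apply: back_colour; rewrite catrevK.
rewrite -{1}(size_next_level v).
apply: (@read_copy _ _ _ _ _ [::] _ _ [::]); first by rewrite size_next_level.
rewrite [false || _]/= size_next_level; case: ifP H => _ H.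
  have e3 : size (catrev (next_level v) [::]) = k.
    by rewrite catrevE cats0 size_rev size_next_level.
  rewrite -{1}e3; apply: back_copy; first by rewrite e3 size_ncons addn0.
  rewrite catrevK; have -> : catrev (ncons k false [::]) [::] = nseq k false.
    by rewrite catrevE cats0 rev_nseq.
  exact: H.
case: H => -> le_t; apply: (@outcome_le _ (size lo).+2); first by lia.
have := @read_output (tape px [::] (flatten rows ++ cols))
  (tape ps (catrev (next_level v) [::]) [::]) (tape pn (ncons k false [::]) [::])
  (tape pc (true :: lc) yc) [::] lo [:: None] [::].
rewrite catrevE cats0; apply; first by case.
by case=> [|[]].
Qed.

Lemma counter_stuck v px ps pn pc lc lo :
  size v = k ->
  read_out level_time (Some RRow) (level_tapes px ps pn pc v lc [::] lo) None.
Proof.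
move=> ev; apply: (@outcome_le _ (k * (k.*2 + 3) + (k.+1 + k.+1).+1)).
  by rewrite /level_time !expnS expn0; nia.
apply: read_to_colour => //; rewrite -[in X in read_out X]ev; apply: read_colour_stuck.
by rewrite orbT.
Qed.

Lemma cols_stuck v px ps pn pc lc yc lo :
  size v = k -> size cols != k ->
  read_out level_time (Some RRow) (level_tapes px ps pn pc v lc yc lo) None.
Proof.
move=> ev ec; apply: (@outcome_le _ (k * (k.*2 + 3) + (k.+1 + k.+1).+1)).
  by rewrite /level_time !expnS expn0; nia.
apply: read_to_colour => //; rewrite -[in X in read_out X]ev; apply: read_colour_stuck.
by rewrite ev ec.
Qed.
End OneLevel.

(** * Reading the order and the root, and malformed inputs *)

Section Setup.
Variables (k : nat).
Implicit Types (v y z : seq bool) (px : seq symb).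

Definition root_tapes px y : seq zipper :=
  [:: tape px [::] y; tape [::] [::] (nseq k false); tape [::] [::] (nseq k false);
      tape [::] [::] (nseq k true); ([:: None], [::])].

Lemma read_to_root t r y :
  (forall px, read_out t (Some (RRoot false)) (root_tapes px y) r) ->
  read_out (k.+1 + (k.+1 + t)) (Some ROnes)
    (tinit read_transducer (nseq k true ++ false :: y)) r.
Proof.
move=> H; apply: (@read_ones _ _ _ _ _ _ [::] _ [::] _ [::]).
have e (b : bool) : size (ncons k b [::]) = k by rewrite size_ncons addn0.
rewrite -{1}(e false); apply: back_ones; rewrite ?e //.
have e2 (b : bool) : catrev (ncons k b [::]) [::] = nseq k b by rewrite catrevE cats0 rev_nseq.
rewrite !e2; have := H (ncons k None [:: None]); exact.
Qed.

Lemma read_setup t r v z :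
  size v = k -> count id v = 1 ->
  (forall px, read_out t (Some RRow)
    [:: tape px [::] z; tape [::] [::] v; tape [::] [::] (nseq k false);
        tape [::] [::] (nseq k true); ([:: None], [::])] r) ->
  read_out (4 * k.+1 + t) (Some ROnes)
    (tinit read_transducer (nseq k true ++ false :: v ++ z)) r.
Proof.
move=> ev cv H; have -> : 4 * k.+1 + t = k.+1 + (k.+1 + (k.+1 + (k.+1 + t))) by lia.
apply: read_to_root => px; rewrite -{1}ev.
apply: (@read_root _ _ _ _ _ _ _ [::]) => // [|px']; first by rewrite size_nseq.
have e : size (catrev v [::]) = k by rewrite catrevE cats0 size_rev.
by rewrite -{1}e; apply: back_root; rewrite catrevK.
Qed.

Lemma read_root_stuck (f : bool) y px ps (ls ys : seq bool) n c o :
  (size y < size ys) || (f + count id (take (size ys) y) != 1) ->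
  read_out (size ys).+1 (Some (RRoot f))
    [:: tape px [::] y; tape ps ls ys; n; c; o] None.
Proof.
elim: ys f px ls y => [|a ys IH] f px ls y.
  by rewrite take0 /=; case: f => // _; rstuck.
case: y => [|b y] /= H; first by case: f {H} => *; rstuck.
case: f H => H; first case: b H => H.
- by rstuck.
- apply: OutcomeStep; first by [].
  by apply: (IH true (None :: px) (false :: ls)); move: H; rewrite ltnS.
apply: OutcomeStep; first by [].
by apply: (IH b (None :: px) (b :: ls)); move: H; rewrite ltnS.
Qed.

End Setup.

Lemma read_ones_stuck k px ps (ls : seq bool) pn (ln : seq bool) pc (lc : seq bool) o :
  read_out k (Some ROnes)
    [:: (px, bits (nseq k true)); tape ps ls [::]; tape pn ln [::];
        tape pc lc [::]; o] None.
Proof.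
elim: k px ls ln lc => [|k IH] px ls ln lc; first by rstuck.
by rstep; apply: (IH (None :: px) (false :: ls) (false :: ln) (true :: lc)).
Qed.

Lemma onesP (x : seq bool) :
  (exists k y, x = nseq k true ++ false :: y) \/ x = nseq (size x) true.
Proof.
elim: x => [|b x [[k [y ->]]|e]]; first by right.
  by case: b; left; [exists k.+1, y | exists 0; eexists].
by case: b; [right; rewrite /= -e | left; exists 0, x].
Qed.

Lemma one_hotE (v : seq bool) : count id v = 1 ->
  index true v < size v /\ v = mkseq (fun i => i == index true v) (size v).
Proof.
move=> cv; have lt_i : index true v < size v.
  have : has id v by rewrite has_count cv.
  by rewrite index_mem => /hasP[[]].
split=> //; rewrite mkseq_eq lt_i.
elim: v cv {lt_i} => //= -[] v IH cv /=; last by rewrite -IH.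
congr (_ :: _); rewrite subn1 /=.
elim: v cv {IH} => //= -[] v IH //= cv.
by rewrite -IH.
Qed.

(** Block lengths and a one-hot root are the only constraints on an encoding, hence the only format
    checks to be made. *)
Lemma encode_lists k v (rows : seq (seq bool)) cols :
  size v = k -> count id v = 1 ->
  size rows = k -> all (fun row => size row == k) rows -> size cols = k ->
  exists G : fgraph unit unit,
    nseq k true ++ false :: v ++ flatten rows ++ cols = encode G.
Proof.
move=> ev /one_hotE[lt_i ->] er arow ec; rewrite ev in lt_i *.
exists (@FGraph unit unit k (fun u _ w => nth false (nth [::] rows u) w)
  (fun w => if nth false cols w then setT else set0) (Ordinal lt_i)).
rewrite encode_unit /=; congr (_ ++ _ :: _ ++ _ ++ _).
- by rewrite -map_enum_ord.
- congr flatten; rewrite -{1}(mkseq_nth [::] rows) er -map_enum_ord.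
  apply: eq_map => u; rewrite (map_enum_ord (nth false (nth [::] rows u))).
  have /eqP eu : size (nth [::] rows u) == k by apply: (all_nthP _ arow); rewrite er.
  by have := mkseq_nth false (nth [::] rows u); rewrite eu.
rewrite -{1}(mkseq_nth false cols) ec -map_enum_ord; apply: eq_map => w.
case: (nth false cols w); [exact/esym/in_setT | exact/esym/in_set0].
Qed.

(** Validation needs no pass of its own: a missing separator or a bad root vector blocks the set-up,
    and a short matrix or a colour vector of wrong length blocks the first level. *)
Lemma read_encode_or_stuck x :
  (exists G : fgraph unit unit, x = encode G) \/
  read_out (20 * (size x).+1 ^ 3) (Some ROnes) (tinit read_transducer x) None.
Proof.
case: (onesP x) => [[k [y ex]]|ex]; last first.
  right; apply: (@outcome_le _ (size x)); first by rewrite !expnS expn0; nia.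
  by rewrite {2}ex; apply: (@read_ones_stuck _ _ _ [::] _ [::] _ [::]).
have le_k : k.+1 <= size x by rewrite ex size_cat size_nseq /=; lia.
have [bad|] := boolP ((size y < k) || (0 + count id (take k y) != 1)).
  right; apply: (@outcome_le _ (k.+1 + (k.+1 + k.+1))); first by rewrite !expnS expn0; nia.
  rewrite ex; apply: read_to_root => px; rewrite -{1}(size_nseq k false).
  by apply: (@read_root_stuck _ _ _ _ [::]); rewrite size_nseq.
rewrite negb_or -leqNgt negbK => /andP[le_ky /eqP cv].
have ev : size (take k y) = k by rewrite size_takel.
have le_t : 4 * k.+1 + level_time k <= 20 * (size x).+1 ^ 3.
  by rewrite /level_time !expnS expn0; nia.
move: ex; rewrite -{1}(cat_take_drop k y); move: (take k y) (drop k y) ev cv.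
move=> v z ev cv ex; case: (ltnP (size z) (k * k)) => [lt_z|le_z].
  right; apply: (outcome_le le_t); rewrite ex; apply: read_setup => // px.
  apply: (@outcome_le _ (k * (k.*2 + 3))).
    by rewrite /level_time !expnS expn0; nia.
  rewrite -{1}ev -{1}(size_nseq k false).
  by apply: (@read_rows_stuck _ _ _ [::] _ [::]); rewrite ev size_nseq.
have sum_k : sumn (nseq k k) = size (take (k * k) z) by rewrite sumn_nseq size_takel.
pose rows := reshape (nseq k k) (take (k * k) z).
have erow : flatten rows = take (k * k) z by rewrite /rows reshapeKr // sum_k.
have sh : shape rows = nseq k k by rewrite /rows reshapeKl // sum_k.
have size_rows : size rows = k by rewrite -(size_map size rows) -/(shape rows) sh size_nseq.
have size_row : all (fun row => size row == k) rows.
  by rewrite -(all_map size (pred1 k)) -/(shape rows) sh all_nseq /= eqxx orbT.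
move: ex; rewrite -(cat_take_drop (k * k) z) -erow => ex.
have [ec|nec] := eqVneq (size (drop (k * k) z)) k.
  by left; rewrite ex; apply: encode_lists.
right; apply: (outcome_le le_t); rewrite ex; apply: read_setup => // px.
exact: (@cols_stuck _ _ _ size_rows size_row _ _ [::] [::] [::] [::] _ [::]).
Qed.

(** * The word spelled by a graph *)

Fixpoint level (G : lgraph unit unit) (i : nat) (v : node G) : Prop :=
  if i is j.+1 then exists2 u, level j u & edge u tt v else v = lroot G.

(** The last nonempty level carries no letter, so that the empty word is read off
    some graphs. *)
Definition reads (G : lgraph unit unit) (w : seq bool) : Prop :=
  [/\ exists v : node G, level (size w) v,
      forall v : node G, ~ level (size w).+1 v
    & forall i, i < size w ->
        (nth false w i <-> exists2 v : node G, level i v & tt \in label v)].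

Section FiniteGraph.
Variable G : fgraph unit unit.
Local Notation n := (forder G).
Implicit Types (A : {set 'I_n}).

Definition post A : {set 'I_n} := [set v | [exists u in A, fedge u tt v]].
Definition pre A : {set 'I_n} := [set u | [exists v in A, fedge u tt v]].
Definition levels i : {set 'I_n} := iter i post [set froot G].
Definition coloured i : bool := [exists v in levels i, tt \in flabel v].

Lemma levelP i v : level (G := G) i v <-> v \in levels i.
Proof.
elim: i v => [|i IH] v /=; first by rewrite inE; split=> /eqP.
rewrite inE; split=> [[u /IH lu uv]|/existsP[u /andP[/IH lu uv]]].
  by apply/existsP; exists u; rewrite lu.
by exists u.
Qed.

Lemma levels_anti i j : i <= j -> levels j != set0 -> levels i != set0.
Proof.
move=> /subnK <-; elim: (j - i) => // k IH; rewrite addSn /= => h; apply: IH.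
apply: contra_neq h => e; apply/setP=> v; rewrite !inE e.
by apply/existsP => -[u]; rewrite inE.
Qed.

Lemma levels_pre i j :
  levels (i + j) != set0 <-> exists2 u, u \in levels i & u \in iter j pre setT.
Proof.
elim: j i => [|j IH] i.
  rewrite addn0; split=> [/set0Pn[u lu]|[u lu _]]; last by apply/set0Pn; exists u.
  by exists u; rewrite // inE.
rewrite addnS -addSn IH; split=> [[v]|[u lu]].
  rewrite inE => /existsP[u /andP[lu uv]] pv; exists u => //=.
  by rewrite inE; apply/existsP; exists v; rewrite pv.
rewrite /= inE => /existsP[v /andP[pv uv]]; exists v => //.
by rewrite inE; apply/existsP; exists u; rewrite lu.
Qed.

(* A node that starts a walk of length [n] starts arbitrarily long walks: the
   sets of nodes starting a walk of length [j] are the iterates of [pre] from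
   [setT], which are stationary from [n] on. *)
Lemma levels_infinite i : levels n != set0 -> levels i != set0.
Proof.
move=> ln; case: (leqP i n) => [le_in|lt_ni]; first exact: levels_anti ln.
have mono_pre : {homo pre : A B / A \subset B}.
  move=> A B sAB; apply/subsetP=> u; rewrite !inE => /existsP[v /andP[Av uv]].
  by apply/existsP; exists v; rewrite (subsetP sAB).
(* [cofixset] is the complement of the least fixpoint of the dual function, which is reached after
   [n] iterations from [set0]. *)
have iterC j : iter j (funsetC pre) set0 = ~: iter j pre setT.
  by elim: j => [|j IH]; rewrite ?setCT //= IH /funsetC setCK.
have stat : iter n pre setT = cofixset pre.
  by rewrite /cofixset /fixset card_ord iterC setCK.
have [u lu pu] := (levels_pre 0 n).1 ln.
apply/(levels_pre 0 i); exists u => //.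
have fix_pre k : iter k pre (cofixset pre) = cofixset pre.
  by elim: k => //= k ->; apply: cofixsetK.
by rewrite -(subnK (ltnW lt_ni)) iterD stat fix_pre -stat.
Qed.

Lemma readsP w : reads G w <->
  [/\ levels (size w) != set0, levels (size w).+1 = set0
    & w = mkseq coloured (size w)].
Proof.
have colP i : coloured i <-> exists2 v, level (G := G) i v & tt \in flabel v.
  split=> [/existsP[v /andP[/levelP lv cv]]|[v /levelP lv cv]]; first by exists v.
  by apply/existsP; exists v; rewrite lv.
split=> [[[v lv] no cw]|[/set0Pn[v lv] no ew]]; split.
- by apply/set0Pn; exists v; apply/levelP.
- by apply/setP=> u; rewrite in_set0; apply/negP => /levelP /no.
- apply: (@eq_from_nth _ false); rewrite ?size_mkseq // => i lt_i.
  rewrite nth_mkseq //; apply/idP/idP => [/(cw i lt_i)[u lu cu]|/colP h].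
    by apply/colP; exists u.
  by apply/(cw i lt_i).
- by exists v; apply/levelP.
- by move=> u /levelP; rewrite no in_set0.
by move=> i lt_i; rewrite {1}ew nth_mkseq.
Qed.

Lemma reads_size w : reads G w -> size w < n.
Proof.
case/readsP=> lw no _; rewrite ltnNge; apply/negP=> le_n.
have ln := levels_anti le_n lw; have := levels_infinite (size w).+1 ln.
by rewrite no eqxx.
Qed.

Definition indicator A : seq bool := [seq v \in A | v <- enum 'I_n].
Definition adjacency : seq (seq bool) :=
  [seq [seq fedge u tt v | v <- enum 'I_n] | u <- enum 'I_n].
Definition colouring : seq bool := [seq tt \in flabel v | v <- enum 'I_n].

Lemma size_indicator A : size (indicator A) = n.
Proof. by rewrite size_map size_enum_ord. Qed.

Lemma size_adjacency : size adjacency = n.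
Proof. by rewrite size_map size_enum_ord. Qed.

Lemma size_adjacency_row : all (fun row => size row == n) adjacency.
Proof. by apply/allP=> row /mapP[u _ ->]; rewrite size_map size_enum_ord. Qed.

Lemma size_colouring : size colouring = n.
Proof. by rewrite size_map size_enum_ord. Qed.

Lemma has_indicator A : has id (indicator A) = (A != set0).
Proof.
rewrite has_map; apply/hasP/set0Pn => [[v _ Av]|[v Av]]; exists v => //.
by rewrite mem_enum.
Qed.

Lemma next_indicator A : next_level n adjacency (indicator A) = indicator (post A).
Proof.
(* Generalised to any list of rows and any accumulator, as [merge_rows] changes its accumulator at
   each row. *)
have gen us (f : 'I_n -> bool) :
    merge_rows [seq u \in A | u <- us]
      [seq [seq fedge u tt v | v <- enum 'I_n] | u <- us] [seq f v | v <- enum 'I_n] =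
    [seq f v || has (fun u => (u \in A) && fedge u tt v) us | v <- enum 'I_n].
  elim: us f => [|u us IH] f /=; first by apply: eq_map => v; rewrite orbF.
  rewrite /merge_row zip_map -map_comp IH; apply: eq_map => v /=.
  by rewrite orbA.
rewrite /next_level; have -> : nseq n false = [seq false | v <- enum 'I_n].
  by rewrite -{1}(size_enum_ord n); elim: (enum _) => //= v e ->.
rewrite gen; apply: eq_map => v /=; rewrite inE.
apply/hasP/existsP => [[u _ Au]|[u Au]]; exists u => //; exact: mem_enum.
Qed.

Lemma colour_indicator i : level_colour colouring (indicator (levels i)) = coloured i.
Proof.
rewrite /level_colour zip_map has_map.
by apply/hasP/existsP => [[v _ Av]|[v Av]]; exists v; rewrite ?mem_enum.
Qed.

(** Invariant of the main loop: at level [i] the counter shows [n - i]. If it runs out, level [n] is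
    nonempty, so all levels are and no word is spelled, in agreement with the stuck run. The summand
    [n.+2] pays for rewinding the output. The result [r] is fixed before the erased cells [px] and
    the other left parts of the tapes. *)
Lemma read_levels j i : i + j = n -> levels i != set0 ->
  exists r, (forall px ps pn pc lc,
    read_out (j.+1 * level_time n + n.+2) (Some RRow)
      (level_tapes n adjacency colouring px ps pn pc (indicator (levels i)) lc
         (nseq j true) (rev (mkseq coloured i))) r)
    /\ forall w, r = Some w <-> reads G w.
Proof.
elim: j i => [|j IH] i e li.
  exists None; split=> [px ps pn pc lc|w].
    apply: (@outcome_le _ (level_time n)); first by lia.
    apply: counter_stuck; rewrite ?size_indicator //.
      exact: size_adjacency.
    exact: size_adjacency_row.
  split=> // /readsP[_ no _].
  have ln : levels n != set0 by rewrite -[X in levels X]e addn0.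
  by have := levels_infinite (size w).+1 ln; rewrite no eqxx.
have [l0|l1] := eqVneq (levels i.+1) set0.
  exists (Some (mkseq coloured i)); split=> [px ps pn pc lc|w].
    rewrite mulSn -addnA; apply: read_level.
    - exact: size_adjacency.
    - exact: size_adjacency_row.
    - exact: size_indicator.
    - exact: size_colouring.
    rewrite next_indicator has_indicator -[post (levels i)]/(levels i.+1) l0 eqxx revK size_rev size_mkseq.
    by split=> //; lia.
  split=> [[<-]|/readsP[lw no ew]].
    by apply/readsP; rewrite size_mkseq.
  suff e' : size w = i by rewrite ew e'.
  case: (ltngtP (size w) i) => // lt_i.
    by have := levels_anti lt_i li; rewrite no eqxx.
  by have := levels_anti lt_i lw; rewrite l0 eqxx.
have [r [H rP]] := IH i.+1 ltac:(lia) l1.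
exists r; split=> // px ps pn pc lc.
rewrite mulSn -addnA; apply: read_level.
- exact: size_adjacency.
- exact: size_adjacency_row.
- exact: size_indicator.
- exact: size_colouring.
rewrite next_indicator has_indicator -[post (levels i)]/(levels i.+1) l1 colour_indicator.
by have := H px ps pn pc (true :: lc); rewrite mkseqS rev_rcons.
Qed.

Lemma read_encode : exists r,
  read_out (20 * n.+1 ^ 3) (Some ROnes) (tinit read_transducer (encode G)) r
  /\ forall w, r = Some w <-> reads G w.
Proof.
have l0 : levels 0 != set0 by apply/set0Pn; exists (froot G); rewrite inE.
have [r [H rP]] := @read_levels n 0 erefl l0; exists r; split=> //.
have er : indicator (levels 0) = [seq v == froot G | v <- enum 'I_n].
  by apply: eq_map => v; rewrite inE.
apply: (@outcome_le _ (4 * n.+1 + (n.+1 * level_time n + n.+2))).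
  by rewrite /level_time !expnS expn0; nia.
rewrite encode_unit -er; apply: read_setup => [||px].
- exact: size_indicator.
- rewrite er count_map (eq_count (a2 := pred1 (froot G))) // count_uniq_mem ?enum_uniq //.
  by rewrite mem_enum.
exact: (H px [::] [::] [::] [::]).
Qed.

End FiniteGraph.

(** * Graph classes of languages *)

Lemma bisimilar_sym (Sigma Col : finType) (G H : lgraph Sigma Col) :
  bisimilar G H -> bisimilar H G.
Proof.
case=> R bR R0; exists (fun v u => R u v) => // v u /bR[e f g].
by split=> // [a v' /g|a u' /f].
Qed.

Lemma bisimilar_trans (Sigma Col : finType) (G H K : lgraph Sigma Col) :
  bisimilar G H -> bisimilar H K -> bisimilar G K.
Proof.
case=> R bR R0 [S bS S0]; exists (fun u w => exists2 v, R u v & S v w); last by exists (lroot H).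
move=> u w [v /bR[e1 f1 g1] /bS[e2 f2 g2]]; split; first by rewrite e1.
  move=> a u' /f1[v' /f2[w' ww' Sw'] Rv'].
  by exists w' => //; exists v'.
move=> a w' /g2[v' /g1[u' uu' Ru'] Sv'].
by exists u' => //; exists v'.
Qed.

Lemma bisimilar_level (G H : lgraph unit unit) (R : node G -> node H -> Prop) i u :
  bisimulation R -> R (lroot G) (lroot H) -> level i u ->
  exists2 v, level i v & R u v.
Proof.
move=> bR R0; elim: i u => [|i IH] u /= => [->|[u' /IH[v' lv' Rv'] e]].
  by exists (lroot H).
have [_ f _] := bR _ _ Rv'; have [v ev Rv] := f _ _ e.
by exists v => //; exists v'.
Qed.

Lemma bisimilar_reads (G H : lgraph unit unit) w :
  bisimilar G H -> reads G w -> reads H w.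
Proof.
move=> GH [[u lu] no cw]; have [S bS S0] := bisimilar_sym GH.
case: GH => R bR R0; split.
- by have [v lv _] := bisimilar_level bR R0 lu; exists v.
- by move=> v /(bisimilar_level bS S0)[u' /no].
move=> i /cw ->; split=> -[x lx cx].
  have [y ly Rxy] := bisimilar_level bR R0 lx; exists y => //.
  by have [<-] := bR _ _ Rxy.
have [y ly Sxy] := bisimilar_level bS S0 lx; exists y => //.
by have [<-] := bS _ _ Sxy.
Qed.

(** The first conjunct is the restriction that [mod_bisim] imposes on its members. *)
Definition word_class (L : language) : graph_class unit unit :=
  fun G => finitely_representable G /\ exists2 w, reads G w & L w.

Lemma word_class_invariant L : bisimulation_invariant (word_class L).
Proof.
move=> G H [[F GF] [w Gw Lw]] GH; split; last first.
  by exists w => //; apply: bisimilar_reads Gw.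
by exists F; apply: bisimilar_trans (bisimilar_sym GH) GF.
Qed.

Lemma finitely_representable_fgraph (Sigma Col : finType) (G : fgraph Sigma Col) :
  finitely_representable G.
Proof.
by exists G, eq => // u _ <-; split=> // a v uv; exists v.
Qed.

Lemma reads_path w : reads (path_graph w) w.
Proof.
have lev i (v : 'I_(size w).+1) : level (G := path_graph w) i v <-> v = i :> nat.
  elim: i v => [|i IH] v /=; first by split=> [->|e] //; apply: val_inj.
  split=> [[u /IH <- /eqP]|e] //.
  have lt_i : i < (size w).+1 by rewrite ltnW // -e ltn_ord.
  by exists (Ordinal lt_i); [apply/IH | rewrite /= e].
split.
- by exists ord_max; apply/lev.
- by move=> v /lev e; have := ltn_ord v; rewrite e ltnn.
move=> i lt_i; split=> [wi|[v /lev <-] /=].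
  by exists (inord i); rewrite /= ?inordK ?ltnS ?(ltnW lt_i) ?wi ?in_setT //;
     apply/lev; rewrite inordK // ltnS ltnW.
by case: (nth false w v); rewrite ?in_set0.
Qed.

(** Both words are the output of the same deterministic run. *)
Lemma encode_reads (G H : fgraph unit unit) v w :
  encode G = encode H -> reads G v -> reads H w -> v = w.
Proof.
have [r [out rP]] := read_encode G; have [s [out' sP]] := read_encode H.
move=> e /rP er /sP es; rewrite -e in out'.
by have := outcome_det out out'; rewrite er es => -[].
Qed.

Lemma membership_reduces_word L :
  reduces read_transducer (cubic 20) (membership_problem (word_class L)) L.
Proof.
move=> x; rewrite cubicE; have [[G ->]|stuck] := read_encode_or_stuck x.
  have [r [out rP]] := read_encode G; exists r.
  have le_n : forder G <= size (encode G).
    by rewrite encode_unit size_cat size_nseq leq_addr.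
  split.
  - by apply: outcome_le out; rewrite leq_mul2l leq_exp2r.
  - case: r rP {out} => [w|] // /(_ w)[/(_ erefl) /reads_size lt_w _] /=.
    by rewrite !expnS expn0; nia.
  (* Membership may be witnessed by another graph [H] with the encoding of [G]; comparing the two
     runs carries the word over to [G]. *)
  split=> [[H e [_ [w Hw Lw]]]|[w /rP Gw Lw]].
    exists w => //; apply/rP.
    have [r' [out' r'P]] := read_encode H; rewrite -e in out'.
    have /r'P er' := Hw; have := outcome_det out out'; rewrite er' => er.
    exact/rP.
  exists G => //; split; first exact: finitely_representable_fgraph.
  by exists w.
exists None; split=> //; split=> [[G e [_ [w Gw _]]]|[w] //].
have [r [out rP]] := read_encode G; rewrite -e in out.
by have /rP er := Gw; have := outcome_det stuck out; rewrite er.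
Qed.

Lemma word_reduces_membership L :
  reduces path_transducer (cubic 20) L (membership_problem (word_class L)).
Proof.
move=> w; rewrite cubicE; exists (Some (path_word w)); split.
- exact: path_transducer_outcome.
- by rewrite /= size_path_word !expnS expn0; nia.
split=> [Lw|[_ [<-] [G e [_ [v Gv Lv]]]]].
  exists (path_word w) => //; exists (path_graph w); first by rewrite encode_path.
  split; first exact: finitely_representable_fgraph.
  by exists w => //; apply: reads_path.
rewrite -encode_path in e.
by rewrite -(encode_reads (esym e) Gv (reads_path w)).
Qed.

Lemma mod_bisim_iff (C D : language -> Prop) (Sigma Col : finType)
    (GG : graph_class Sigma Col) :
  (forall L, C L <-> D L) -> mod_bisim C GG <-> mod_bisim D GG.
Proof. by move=> CD; split=> -[? ? ? ? /CD]. Qed.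

(** From right to left, for [L] in [C]: reading graphs puts the membership problem of [word_class L]
    into [C], the hypothesis moves it to [PTIME], and writing paths brings [L] itself there. *)
Lemma collapse_mod_bisim (C : language -> Prop) :
  (forall L, PTIME L -> C L) ->
  (forall T p L L', reduces T p L' L -> C L -> C L') ->
  (forall L, PTIME L <-> C L) <->
  (forall (Sigma Col : finType) (GG : graph_class Sigma Col),
     mod_bisim PTIME GG <-> mod_bisim C GG).
Proof.
move=> subC redC; split=> [eqC Sigma Col GG|eqC L]; first exact: mod_bisim_iff.
split=> [|CL]; first exact: subC.
apply: (PTIME_reduces (word_reduces_membership L)).
suff /eqC[] : mod_bisim C (word_class L) by [].
split; rewrite ?card_unit //; first by move=> G [].
  exact: word_class_invariant.
exact: redC (membership_reduces_word L) CL.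
Qed.

Theorem theorem1 :
  ((forall L : language, PTIME L <-> NPTIME L) <->
   (forall (Sigma Col : finType) (GG : graph_class Sigma Col),
      mod_bisim PTIME GG <-> mod_bisim NPTIME GG))
  /\
  ((forall L : language, PTIME L <-> PSPACE L) <->
   (forall (Sigma Col : finType) (GG : graph_class Sigma Col),
      mod_bisim PTIME GG <-> mod_bisim PSPACE GG)).
Proof.
split; apply: collapse_mod_bisim.
- exact: PTIME_NPTIME.
- by move=> T p L L'; apply: NPTIME_reduces.
- exact: PTIME_PSPACE.
- by move=> T p L L'; apply: PSPACE_reduces.
Qed.
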